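(* As $\mathcal{L}(D)$-processes, with $D=1_\pi^\perp$, the Brownian time field $B=\{B(f,t):f\in 1_\pi^\perp,\ t\in\mathbb{R}\}$ and the stationary field $Z=\{Z(f,t):f\in 1_\pi^\perp,\ t\in\mathbb{R}\}$ possess continuous regular versions.
   Context: Setting: $X=\{X(t):t\ge0\}$ is a progressively measurable continuous-parameter Markov process on a measurable state space $(S,\mathcal{S})$, defined on a complete probability space, starting from an ergodic invariant probability $\pi$. $L^2(S,\pi)$ has inner product $\langle\cdot,\cdot\rangle_\pi$, and $1_\pi^\perp=\{f\in L^2(S,\pi):\langle f,1\rangle_\pi=0\}$. Assumption on the generator: $A$ is a densely defined self-adjoint infinitesimal generator on $L^2(S,\pi)$ of the strongly continuous semigroup of $X$, with ergodic invariant probability $\pi$, such that $A^{-1}$ (the inverse of the bijection $A:\mathcal{D}(A)\cap\mathcal{N}(A)^\perp\to\mathcal{R}(A)$, where $\mathcal{N}(A)$ and $\mathcal{R}(A)$ are the null space and range of $A$) is a bounded linear operator on $\mathcal{R}(A)=1_\pi^\perp$. Brownian field: $B=\{B(f,t):f\in 1_\pi^\perp,t\in\mathbb{R}\}$ is the centered Gaussian field, linear in $f$, with $\mathrm{cov}(B(f_1,t_1),B(f_2,t_2))=(|t_1|\wedge|t_2|)(-2\langle f_1,A^{-1}f_2\rangle_\pi)$ if $t_1t_2>0$ and $0$ if $t_1t_2\le 0$. (It arises as the weak limit of the additive functionals $n^{-1/2}\int_0^{nt}f(X_s)\,ds$, extended to two-sided time.) Stationary field: for a fixed $\gamma<0$,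 $Z(f,t)=e^{-|\gamma|t}\frac{1}{\sqrt{2|\gamma|}}B(f,e^{2|\gamma|t})$ for $f\in 1_\pi^\perp$, $t\in\mathbb{R}$. Put $\Gamma=\gamma\mathbf{I}=-|\gamma|\mathbf{I}$. Rigged Hilbert space: let $D=\mathcal{D}(\Gamma)=1_\pi^\perp$, and let $p(f,g)=\frac{1}{|\gamma|}\langle f,(-A)^{-1}g\rangle_\pi$ and $r(f,g)=p((I-\Gamma)f,(I-\Gamma)g)=\frac{(1+|\gamma|)^2}{|\gamma|}\langle f,(-A)^{-1}g\rangle_\pi$ for $f,g\in 1_\pi^\perp$, where $(D,r)$ is taken to be a separable Hilbert space. Write $r(f)=r(f,f)^{1/2}$. Let $\{d_n\}$ be an orthonormal basis of $(D,r)$ with $d_n\in\mathcal{D}(\Gamma^2)=1_\pi^\perp$ for each $n$, let $\{\lambda_n\}$ be a sequence of positive numbers with $\sum_n\lambda_n^2<\infty$, and let $Kf=\sum_n\lambda_n r(d_n,f)\,d_n$, $f\in D$, a strictly positive definite Hilbert–Schmidt operator on $(D,r)$. Let $D_K=KD$ with inner product $r_K(f,g)=r(K^{-1}f,K^{-1}g)$, a separable Hilbert space. $(H,\|\cdot\|)$ is the dual space of bounded linear functionals on $(D_K,r_K)$; the triple $(D_K,r_K),(D,r),(H,\|\cdot\|)$ is a Gelfand triple (rigged Hilbert space). $\langle y|f\rangle$ denotes the value of $y\in H$ at $f\in D_K$. Terminology: an $\mathcal{L}(D)$-process is a stochastic process indexed by time $t\in\mathbb{R}$ with values in the linear functionals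 on the real vector space $D$. An $H$-process is a family $\{Y(t):t\in\mathbb{R}\}$ of $H$-valued random variables; it is sample continuous if for each $\omega$ the map $t\mapsto Y(t,\omega)$ is continuous for the norm of $H$. A sample continuous process $Y'$ is a continuous version of an $H$-process $Y$ if $Y(t)=Y'(t)$ a.s. for every $t$. If $Y$ is an $\mathcal{L}(D)$-process and, for each $t$, $\tilde Y(t)$ is a regular version of $Y(t)$ (an $H$-valued random variable with $\langle\tilde Y(t)|f\rangle=Y(f,t)$ a.s. for each $f\in D_K$), then a continuous version of $\tilde Y$, if it exists, is called a continuous regular version of $Y$. *)

(* Defs.v *)
From HB Require Import structures.
From mathcomp Require Import all_boot all_order all_algebra.
From mathcomp Require Import all_classical all_reals all_analysis.
From mathcomp Require Import measurable_realfun.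
Set Implicit Arguments.
Unset Strict Implicit.
Unset Printing Implicit Defensive.
Import Order.TTheory GRing.Theory Num.Theory.
Import numFieldNormedType.Exports.
Local Open Scope classical_set_scope.
Local Open Scope ring_scope.

(* L2 is the Lspace of the library (classes of measurable functions modulo
   almost everywhere equality, see [L2P]); what is added here is its vector
   space structure and its inner product *)
Section L2_space.
Context d (S : measurableType d) (R : realType).
Variable mu : {measure set S -> \bar R}.

Definition L2 : Type := LspaceType2 mu.

HB.instance Definition _ := gen_eqMixin L2.
HB.instance Definition _ := gen_choiceMixin L2.

Lemma L2fun_Lfun (f : L2) : (f : S -> R) \in Lfun mu 2%:E.
Proof.
rewrite inE; apply/andP; split; rewrite inE/=.
  exact: (@measurable_funPT _ _ _ _ (repr (LebesgueSpace.sort f))).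
exact: Lebesgue_finite.
Qed.

Lemma L2fun_measurable (f : L2) : measurable_fun setT (f : S -> R).
Proof. by have /andP[/[!inE]] := L2fun_Lfun f. Qed.

Lemma L2P (f g : L2) : f = g <-> {ae mu, forall x, f x = g x}.
Proof.
split=> [->|fg]; first exact: nearW.
suff sfg : LebesgueSpace.sort f = LebesgueSpace.sort g.
  case: f g fg sfg => [f [[Pf]]] [g [[Pg]]] /= _ fg.
  by case: _ / fg Pg => Pg; rewrite (bool_irrelevance Pf Pg).
rewrite -[LHS]reprK -[RHS]reprK; apply/eqP; rewrite eqmodE; apply/asboolP.
by apply: filterS fg => x.
Qed.

Lemma finite_norm2_ae (f g : {mfun S >-> measurableTypeR R}) :
  {ae mu, forall x, f x = g x} ->
  finite_norm mu 2%:E (f : S -> R) -> finite_norm mu 2%:E (g : S -> R).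
Proof.
move=> fg; rewrite /finite_norm unlock => fin.
have mp (h : {mfun S >-> measurableTypeR R}) :
    measurable_fun setT (fun x => (`|((h : S -> R) x)%:E| `^ 2)%E : \bar R).
  rewrite (_ : (fun x => _) = EFin \o (fun x => `|(h : S -> R) x| `^ 2)).
    apply/measurable_EFinP; apply: (measurableT_comp (measurable_powR _)) => //.
    by apply: measurableT_comp => //; exact: (@measurable_funPT _ _ S _ h).
  by apply/funext.
rewrite (@ae_eq_integral _ _ _ _ _
  (fun x => (`|((f : S -> R) x)%:E| `^ 2)%E))//.
- exact: mp.
- by move: fg; apply: filterS => x fgx _ /=; rewrite fgx.
Qed.

Lemma ae_repr_pi (f : {mfun S >-> measurableTypeR R}) :
  {ae mu, forall x,
    (repr (\pi_({mfun_ mu, S >-> measurableTypeR R})%qT f)) x = f x}.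
Proof.
have /eqP := reprK (\pi_({mfun_ mu, S >-> measurableTypeR R})%qT f).
by rewrite eqmodE => /asboolP; apply: filterS => x; exact.
Qed.

(* a class whose chosen representative is almost everywhere equal to f *)
Lemma L2_of_subproof (f : S -> R) (fL : f \in Lfun mu 2%:E) :
  exists h : L2, {ae mu, forall x, h x = f x}.
Proof.
have mf : measurable_fun setT (f : S -> measurableTypeR R).
  by move: fL => /andP[/[!inE]].
pose F : {mfun S >-> measurableTypeR R} :=
  HB.pack f (isMeasurableFun.Build _ _ S (measurableTypeR R) f mf).
have F2 : finite_norm mu 2%:E (F : S -> R) by move: fL => /andP[_ /[!inE]].
pose q : {mfun_ mu, S >-> measurableTypeR R} :=
  (\pi_({mfun_ mu, S >-> measurableTypeR R})%qT F).
have q2 : finite_norm mu 2%:E (q : S -> R).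
  apply: finite_norm2_ae F2; apply: filterS (ae_repr_pi F) => x; exact: esym.
exists (LebesgueSpace.Pack (LebesgueSpace.Class
  (isFinLebesgue.Build _ _ _ mu _ (lee1n 2) q q2))).
exact: ae_repr_pi.
Qed.

Definition L2_of (f : S -> R) (fL : f \in Lfun mu 2%:E) : L2 :=
  sval (cid (L2_of_subproof fL)).

Lemma L2_ofE (f : S -> R) (fL : f \in Lfun mu 2%:E) :
  {ae mu, forall x, L2_of fL x = f x}.
Proof. by rewrite /L2_of; case: cid. Qed.

Let Lfun2_submod_closed : submod_closed (Lfun mu 2%:E).
Proof. exact: Lfun_submod_closed (lee1n 2). Qed.

Lemma L2_zero_subproof : (fun=> 0) \in Lfun mu 2%:E.
Proof. by have [+ _] := Lfun2_submod_closed. Qed.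

Lemma L2_scale_subproof (a : R) (f : L2) : (fun x => a * f x) \in Lfun mu 2%:E.
Proof.
have [z0 /(_ a _ _ (L2fun_Lfun f) z0)] := Lfun2_submod_closed.
by rewrite addr0.
Qed.

Lemma L2_add_subproof (f g : L2) : (fun x => f x + g x) \in Lfun mu 2%:E.
Proof.
have [_ /(_ 1 _ _ (L2fun_Lfun f) (L2fun_Lfun g))] := Lfun2_submod_closed.
by rewrite scale1r.
Qed.

Definition L2_zero : L2 := L2_of L2_zero_subproof.
Definition L2_add (f g : L2) : L2 := L2_of (L2_add_subproof f g).
Definition L2_scale (a : R) (f : L2) : L2 := L2_of (L2_scale_subproof a f).
Definition L2_opp (f : L2) : L2 := L2_scale (-1) f.

Lemma L2_zeroE : {ae mu, forall x, L2_zero x = 0}.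
Proof. exact: L2_ofE. Qed.
Lemma L2_addE f g : {ae mu, forall x, L2_add f g x = f x + g x}.
Proof. exact: L2_ofE. Qed.
Lemma L2_scaleE a f : {ae mu, forall x, L2_scale a f x = a * f x}.
Proof. exact: L2_ofE. Qed.

Lemma L2_addA : associative L2_add.
Proof.
move=> f g h; apply/L2P; near=> x.
have -> : L2_add f (L2_add g h) x = f x + L2_add g h x.
  by near: x; exact: L2_addE.
have -> : L2_add (L2_add f g) h x = L2_add f g x + h x.
  by near: x; exact: L2_addE.
have -> : L2_add g h x = g x + h x by near: x; exact: L2_addE.
have -> : L2_add f g x = f x + g x by near: x; exact: L2_addE.
by rewrite addrA.
Unshelve. all: by end_near. Qed.

Lemma L2_addC : commutative L2_add.
Proof.
move=> f g; apply/L2P; have := L2_addE f g; have := L2_addE g f.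
by apply: filterS2 => x -> ->; rewrite addrC.
Qed.

Lemma L2_add0 : left_id L2_zero L2_add.
Proof.
move=> f; apply/L2P; have := L2_addE L2_zero f; have := L2_zeroE.
by apply: filterS2 => x e1 ->; rewrite e1 add0r.
Qed.

Lemma L2_addN : left_inverse L2_zero L2_opp L2_add.
Proof.
move=> f; apply/L2P; have := L2_addE (L2_opp f) f; have := L2_zeroE.
have := L2_scaleE (-1) f.
by apply: filterS3 => x e1 -> ->; rewrite e1 mulN1r addNr.
Qed.

HB.instance Definition _ :=
  GRing.isZmodule.Build L2 L2_addA L2_addC L2_add0 L2_addN.

Lemma L2_scaleA a b f : L2_scale a (L2_scale b f) = L2_scale (a * b) f.
Proof.
apply/L2P; have := L2_scaleE a (L2_scale b f); have := L2_scaleE b f.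
have := L2_scaleE (a * b) f.
by apply: filterS3 => x -> e ->; rewrite e mulrA.
Qed.

Lemma L2_scale1 : left_id 1 L2_scale.
Proof.
move=> f; apply/L2P; have := L2_scaleE 1 f.
by apply: filterS => x ->; rewrite mul1r.
Qed.

Lemma L2_scaleDr : right_distributive L2_scale +%R.
Proof.
move=> a f g; apply/L2P; near=> x.
have -> : L2_scale a (f + g) x = a * (f + g) x by near: x; exact: L2_scaleE.
have -> : (f + g) x = f x + g x by near: x; exact: L2_addE.
have -> : (L2_scale a f + L2_scale a g) x = L2_scale a f x + L2_scale a g x.
  by near: x; exact: L2_addE.
have -> : L2_scale a f x = a * f x by near: x; exact: L2_scaleE.
have -> : L2_scale a g x = a * g x by near: x; exact: L2_scaleE.
by rewrite mulrDr.
Unshelve. all: by end_near. Qed.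

Lemma L2_scaleDl f : {morph L2_scale^~ f : a b / a + b}.
Proof.
move=> a b; apply/L2P; near=> x.
have -> : L2_scale (a + b) f x = (a + b) * f x by near: x; exact: L2_scaleE.
have -> : (L2_scale a f + L2_scale b f) x = L2_scale a f x + L2_scale b f x.
  by near: x; exact: L2_addE.
have -> : L2_scale a f x = a * f x by near: x; exact: L2_scaleE.
have -> : L2_scale b f x = b * f x by near: x; exact: L2_scaleE.
by rewrite mulrDl.
Unshelve. all: by end_near. Qed.

HB.instance Definition _ := GRing.Zmodule_isLmodule.Build R L2
  L2_scaleA L2_scale1 L2_scaleDr L2_scaleDl.

Lemma L2DE (f g : L2) : {ae mu, forall x, (f + g) x = f x + g x}.
Proof. exact: L2_addE. Qed.
Lemma L2ZE (a : R) (f : L2) : {ae mu, forall x, (a *: f) x = a * f x}.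
Proof. exact: L2_scaleE. Qed.

Definition L2dot (f g : L2) : R := \int[mu]_x (f x * g x).

Lemma L2dot_integrable (f g : L2) :
  mu.-integrable setT (fun x => (f x * g x)%:E).
Proof.
exact/Lfun1_integrable/(Lfun2_mul_Lfun1 (L2fun_Lfun f) (L2fun_Lfun g)).
Qed.

Lemma L2dotP (a : R) (f g h : L2) :
  L2dot (a *: f + g) h = a * L2dot f h + L2dot g h.
Proof.
have ifh := L2dot_integrable f h; have igh := L2dot_integrable g h.
have iafh : mu.-integrable setT (fun x => (a * (f x * h x))%:E).
  by have := integrableZl measurableT a ifh.
have isum : mu.-integrable setT (fun x => (a * (f x * h x) + g x * h x)%:E).
  by have := integrableD measurableT iafh igh.
rewrite /L2dot -RintegralZl// -RintegralD//; congr fine.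
apply: ae_eq_integral => //.
- exact: measurable_int (L2dot_integrable _ _).
- exact: measurable_int isum.
near=> x => _.
have -> : (a *: f + g) x = (a *: f) x + g x by near: x; exact: L2DE.
have -> : (a *: f) x = a * f x by near: x; exact: L2ZE.
by rewrite mulrDl mulrA.
Unshelve. all: by end_near. Qed.

End L2_space.

Section mean_zero.
Context d (S : measurableType d) (R : realType).
Variable mu : {finite_measure set S -> \bar R}.

Definition L2one : L2 mu := L2_of (Lfun_cst mu 1 2).

(* the orthogonal complement of the constants, as a subspace of L2 mu and as
   a real vector space of its own *)
Definition perp1 : {pred L2 mu} := [pred f | L2dot f L2one == 0].

Lemma perp1_submod_closed : submod_closed perp1.
Proof.
have P : forall (a : R) (f g : L2 mu), f \in perp1 -> g \in perp1 ->
    a *: f + g \in perp1.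
  move=> a f g; rewrite !inE => /eqP f0 /eqP g0.
  by rewrite L2dotP f0 g0 mulr0 addr0.
split=> //; rewrite inE.
by have := L2dotP (-1) 0 0 L2one; rewrite scaler0 addr0 mulN1r addNr => ->.
Qed.

HB.instance Definition _ := GRing.isSubmodClosed.Build R (L2 mu) perp1
  perp1_submod_closed.

Definition perp1_space : Type := {f : L2 mu | f \in perp1}.
HB.instance Definition _ := SubType.on perp1_space.
HB.instance Definition _ := [Choice of perp1_space by <:].
HB.instance Definition _ := [SubChoice_isSubLmodule of perp1_space by <:].


End mean_zero.
Arguments perp1 {d S R} mu _.

Section inner_product_spaces.
Context (R : realType) (V : lmodType R) (q : V -> V -> R).

Definition form_norm (f : V) : R := Num.sqrt (q f f).

Definition inner_product : Prop :=
  [/\ forall f g, q f g = q g f,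
      forall (a : R) f g h, q (a *: f + g) h = a * q f h + q g h &
      forall f, f != 0 -> 0 < q f f].

Definition form_complete : Prop :=
  forall u : nat -> V,
    (forall e : R, 0 < e -> exists N, forall m n, (N <= m)%N -> (N <= n)%N ->
      form_norm (u m - u n) < e) ->
    exists f, (fun n => form_norm (u n - f)) @ \oo --> (0 : R).

Definition form_separable : Prop :=
  exists u : nat -> V, forall f (e : R), 0 < e ->
    exists n, form_norm (f - u n) < e.

Definition separable_hilbert : Prop :=
  [/\ inner_product, form_complete & form_separable].

(* The elements d n of the basis are those with n in J, so that J = setT gives
   a sequence and J finite covers a finite-dimensional space; d is irrelevant
   outside J *)
Definition orthonormal_basis (J : set nat) (d : nat -> V) : Prop :=
  (forall i j, J i -> J j -> q (d i) (d j) = (i == j)%:R) /\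
  (forall f, (fun n => form_norm
     (\sum_(0 <= k < n | k \in J) q (d k) f *: d k - f)) @ \oo --> (0 : R)).

(* K f is the sum in norm of the l k * q (d k) f *: d k, k in J *)
Definition diagonal_operator (J : set nat) (d : nat -> V) (l : nat -> R)
    (K : V -> V) : Prop :=
  forall f, (fun n => form_norm
     (\sum_(0 <= k < n | k \in J) (l k * q (d k) f) *: d k - K f))
    @ \oo --> (0 : R).

(* r_K, to be used on the range of K only; 'pinv_ is the inverse of K there *)
Definition range_form (K : V -> V) (f g : V) : R :=
  q ('pinv_(fun=> 0) setT K f) ('pinv_(fun=> 0) setT K g).

End inner_product_spaces.

Section dual_space.
Context (R : realType) (V : lmodType R) (q : V -> V -> R) (W : set V).

(* bounded linear functionals on the subspace W of V normed by q *)
Record dual := Dual {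
  dual_fun :> W -> R ;
  dual_linear : forall (a : R) (f g h : W),
    val h = a *: val f + val g -> dual_fun h = a * dual_fun f + dual_fun g ;
  dual_bounded : exists C : R, forall f : W,
    `|dual_fun f| <= C * form_norm q (val f) }.

Definition dual_norm (y : W -> R) : R :=
  sup [set `|y f| | f in [set f : W | form_norm q (val f) <= 1]].

Definition dual_dist (y z : dual) : R := dual_norm (fun f => y f - z f).

Definition dual_open : set (set dual) :=
  [set U | forall y, U y ->
     exists2 e : R, 0 < e & forall z, dual_dist z y < e -> U z].

Context d (Omega : measurableType d) (P : probability Omega R).

(* measurability for the Borel sigma-algebra of the norm *)
Definition dual_random_variable (Y : Omega -> dual) : Prop :=
  forall C, <<s dual_open >> C -> measurable (Y @^-1` C).

Definition dual_process (Y : R -> Omega -> dual) : Prop :=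
  forall t, dual_random_variable (Y t).

Definition sample_continuous (Y : R -> Omega -> dual) : Prop :=
  forall w t, dual_dist (Y s w) (Y t w) @[s --> t] --> (0 : R).

Definition continuous_version (Y Y' : R -> Omega -> dual) : Prop :=
  [/\ dual_process Y', sample_continuous Y' &
      forall t, {ae P, forall w, Y t w = Y' t w}].

Definition regular_version (Y : Omega -> {linear V -> R^o})
    (Y' : Omega -> dual) : Prop :=
  dual_random_variable Y' /\
  forall f : W, {ae P, forall w, Y' w f = Y w (val f)}.

Definition continuous_regular_version (Y : R -> Omega -> {linear V -> R^o})
    (Y' : R -> Omega -> dual) : Prop :=
  exists2 Yt : R -> Omega -> dual,
    forall t, regular_version (Y t) (Yt t) & continuous_version Yt Y'.

Definition has_continuous_regular_version
    (Y : R -> Omega -> {linear V -> R^o}) : Prop :=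
  exists Y', continuous_regular_version Y Y'.

End dual_space.

Section random_fields.
Context (R : realType) d (Omega : measurableType d) (P : probability Omega R).

(* the values of the process are linear functionals for every w *)
Definition linear_process (V : lmodType R)
    (Y : R -> Omega -> {linear V -> R^o}) : Prop :=
  forall t f, measurable_fun setT (fun w => Y t w f : R).

(* normal_prob m 0 is a junk value, hence the separate degenerate case *)
Definition gaussian (X : Omega -> R) : Prop :=
  measurable_fun setT X /\
  exists m s : R, forall C : set R, measurable C ->
    P (X @^-1` C) = if s == 0 then \d_m C else normal_prob m s C.

Definition centered_gaussian_field (I : Type) (Y : I -> Omega -> R) : Prop :=
  (forall n (a : 'I_n -> R) (i : 'I_n -> I),
     gaussian (fun w => \sum_k a k * Y (i k) w)) /\
  (forall i, 'E_P[Y i] = 0)%E.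

Definition brownian_field (V : lmodType R) (c : V -> V -> R)
    (B : R -> Omega -> {linear V -> R^o}) : Prop :=
  [/\ linear_process B,
      centered_gaussian_field (fun (i : V * R) w => B i.2 w i.1 : R) &
      forall f1 f2 t1 t2,
        covariance P (fun w => B t1 w f1 : R) (fun w => B t2 w f2 : R) =
        (if 0 < t1 * t2 then Num.min `|t1| `|t2| * c f1 f2 else 0)%:E].

Definition stationary_field (V : lmodType R) (gamma : R)
    (B : R -> Omega -> {linear V -> R^o}) : R -> Omega -> {linear V -> R^o} :=
  fun t w => (expR (- `|gamma| * t) * (Num.sqrt (2 * `|gamma|))^-1) \*:
             B (expR (2 * `|gamma| * t)) w.

End random_fields.

Section markov.
Context dS (S : measurableType dS) (R : realType).

(* p t x C is the probability of a transition from x to C in time t >= 0;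
   negative times are irrelevant everywhere below *)
Definition transition_function (p : R -> R.-pker S ~> S) : Prop :=
  (forall x C, measurable C -> p 0 x C = \d_x C) /\
  (forall s t x C, 0 <= s -> 0 <= t -> measurable C ->
     p (s + t) x C = (\int[p s x]_y p t y C)%E).

Definition invariant (pi : probability S R) (p : R -> R.-pker S ~> S) : Prop :=
  forall t C, 0 <= t -> measurable C -> (\int[pi]_x p t x C = pi C)%E.

Definition ergodic (pi : probability S R) (p : R -> R.-pker S ~> S) : Prop :=
  forall C, measurable C ->
    (forall t, 0 <= t -> {ae pi, forall x, p t x C = (\1_C x)%:E}) ->
    pi C = 0%E \/ pi C = 1%E.

Context dO (Omega : measurableType dO) (P : probability Omega R).

Definition filtration (F : R -> set (set Omega)) : Prop :=
  (forall t, 0 <= t -> sigma_algebra setT (F t) /\ F t `<=` measurable) /\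
  (forall s t, 0 <= s -> s <= t -> F s `<=` F t).

(* (s, w) |-> X s w is measurable on [0, t] x Omega for the product of the Borel
   sigma-algebra of [0, t] and F t *)
Definition progressively_measurable (F : R -> set (set Omega))
    (X : R -> Omega -> S) : Prop :=
  forall t C, 0 <= t -> measurable C ->
    <<s `[0, t] `*` setT,
        [set E `*` G | E in [set E : set R | measurable E /\ E `<=` `[0, t]]
                     & G in F t] >>
      [set u | u.1 \in `[0, t] /\ C (X u.1 u.2)].

Definition markov_property (F : R -> set (set Omega))
    (p : R -> R.-pker S ~> S) (X : R -> Omega -> S) : Prop :=
  forall s t E C, 0 <= s -> 0 <= t -> F s E -> measurable C ->
    (P (E `&` X (s + t)%R @^-1` C) = \int[P]_(w in E) p t (X s w) C)%E.

Record ergodic_markov_process (pi : probability S R)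
    (p : R -> R.-pker S ~> S) (F : R -> set (set Omega))
    (X : R -> Omega -> S) : Prop := {
  emp_complete : measure_is_complete P ;
  emp_transition : transition_function p ;
  emp_filtration : filtration F ;
  emp_progressive : progressively_measurable F X ;
  emp_markov : markov_property F p X ;
  emp_invariant : invariant pi p ;
  emp_ergodic : ergodic pi p ;
  emp_initial : forall C, measurable C -> P (X 0 @^-1` C) = pi C }.

End markov.

Section generator.
Context d (S : measurableType d) (R : realType) (pi : probability S R).
Implicit Types (T : R -> L2 pi -> L2 pi) (A : L2 pi -> L2 pi).
Implicit Types (D : set (L2 pi)).

Local Notation nrm := (form_norm (@L2dot _ _ _ pi)).

(* T t f = E(f (X t) | X 0 = .) *)
Definition transition_semigroup (p : R -> R.-pker S ~> S) T : Prop :=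
  forall t f, 0 <= t -> {ae pi, forall x, T t f x = \int[p t x]_y f y}.

Definition strongly_continuous T : Prop :=
  forall f, nrm (T t f - f) @[t --> 0^'+] --> (0 : R).

Definition is_generator_value T (f g : L2 pi) : Prop :=
  nrm (t^-1 *: (T t f - f) - g) @[t --> 0^'+] --> (0 : R).

Definition generator_dom T : set (L2 pi) :=
  [set f | exists g, is_generator_value T f g].

Definition generator T (f : L2 pi) : L2 pi :=
  xget 0 [set g | is_generator_value T f g].

Definition densely_defined D : Prop :=
  forall f (e : R), 0 < e -> exists2 g, D g & nrm (f - g) < e.

(* the graph of the adjoint of A : D -> L2 pi is the graph of A *)
Definition self_adjoint D A : Prop :=
  forall g h, (forall f, D f -> L2dot (A f) g = L2dot f h) <-> D g /\ A g = h.

Definition null_space D A : set (L2 pi) := [set f | D f /\ A f = 0].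

Definition orthogonal_complement (N : set (L2 pi)) : set (L2 pi) :=
  [set f | forall g, N g -> L2dot f g = 0].

(* the inverse of A : D `&` N(A)^perp -> R(A) *)
Definition reduced_inverse D A : L2 pi -> L2 pi :=
  'pinv_(fun=> 0) (D `&` orthogonal_complement (null_space D A)) A.

Definition bounded_on D A : Prop :=
  exists C : R, forall f, D f -> nrm (A f) <= C * nrm f.

Record generator_assumption (D : set (L2 pi)) (A : L2 pi -> L2 pi) : Prop := {
  gen_dense : densely_defined D ;
  gen_self_adjoint : self_adjoint D A ;
  gen_range : A @` D = [set f | f \in perp1 pi] ;
  gen_inverse_bounded :
    bounded_on [set f | f \in perp1 pi] (reduced_inverse D A) }.

End generator.

Section forms.
Context d (S : measurableType d) (R : realType) (pi : probability S R).
Variables (Ainv : L2 pi -> L2 pi) (gamma : R).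
Implicit Types f g : perp1_space pi.

Definition brownian_form f g : R := - 2 * L2dot (val f) (Ainv (val g)).

Definition Gamma f : perp1_space pi := gamma *: f.

(* (-A)^-1 is - A^-1 *)
Definition p_form f g : R := `|gamma|^-1 * L2dot (val f) (- Ainv (val g)).

Definition r_form f g : R := p_form (f - Gamma f) (g - Gamma g).

End forms.

(* Main.v *)
(* The forms <f, (-A)^-1 g> of the covariance of B and of r are proportional, so
   the coordinates B(d_n, t) along an orthonormal basis of (D, r) are Gaussian
   with increments of variance c |s - t|, c not depending on n, and r_K turns a
   bounded functional into a sequence of l^2 with the summable weights
   lambda_n^2. Fourth moments of the increments are at most C |s - t|^2 uniformly
   in n, so chaining along dyadic times gives each coordinate a modulus of
   continuity h_n * omega with sum_n lambda_n^2 E h_n^4 finite: almost surely all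
   coordinates converge along dyadic times to paths that are jointly continuous
   in the weighted l^2 norm. They are the coordinates of the version of B; that
   of Z is obtained by rescaling it and changing its time. *)

Require Import Defs.
From HB Require Import structures.
From mathcomp Require Import all_boot all_order all_algebra.
From mathcomp Require Import all_classical all_reals all_analysis.
From mathcomp Require Import measurable_realfun.
From mathcomp Require Import ring lra.
Set Implicit Arguments.
Unset Strict Implicit.
Unset Printing Implicit Defensive.
Import Order.TTheory GRing.Theory Num.Theory.
Import numFieldNormedType.Exports.
Local Open Scope classical_set_scope.
Local Open Scope ring_scope.

(** * Gaussian fourth moments *)

(** Second moments of the increments would not do: level m of the grid holds about 3^m increments of
    variance of order 2^-m, whose sum grows like (3/2)^m, while their fourth moments are of order
    4^-m and leave room for a geometric weight. One random variable collects the weighted fourth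
    powers over all coordinates, levels and grid points; its finite expectation yields a single null
    set for all of them. On that null set the coordinates are set to 0, because finiteness and
    continuity are demanded at every sample point. The field is linear in f at each sample point,
    but its continuity in f is only an L^4 one. The version is therefore identified with the field
    through the Fourier partial sums of f: the values of the field there converge in L^4 to its
    value at f, and almost surely to the series that defines the functional. The operator K enters
    only through its expansion in norm, hence through the Fourier coefficients, which it multiplies
    by lambda_n. *)

Section gaussian_moments.
Context (R : realType).
Notation leb := (@lebesgue_measure R).

Lemma sqr_le_expR (x : R) : 0 <= x -> x ^+ 2 <= expR x.
Proof.
move=> x0; have h := expR_ge1Dx (x / 4).
(* After this it suffices that (1 + x/4)^2 >= x, where the two sides differ by (1 - x/4)^2. *)
have -> : expR x = (expR (x / 4) ^+ 2) ^+ 2.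
  by rewrite -!expRM_natr; congr expR; field.
rewrite lerXn2r// ?nnegrE ?sqr_ge0//.
apply: (@le_trans _ _ ((1 + x / 4) ^+ 2)).
  by have := sqr_ge0 (1 - x / 4); lra.
by rewrite lerXn2r// nnegrE ?expR_ge0//; lra.
Qed.

(** The change of variables is available for the Radon-Nikodym derivative, which agrees almost
    everywhere with the density because both have the same integral over every measurable set. *)
Lemma integral_normal_prob (m s : R) (f : R -> \bar R) :
  (forall x, 0 <= f x)%E -> measurable_fun setT f ->
  (\int[normal_prob m s]_x f x = \int[leb]_x (f x * (normal_pdf m s x)%:E))%E.
Proof.
move=> f0 mf.
have dom := normal_prob_dominates m s.
rewrite -(Radon_Nikodym_SigmaFinite.change_of_variables dom)//.
have RNae : ae_eq leb setT
    (Radon_Nikodym_SigmaFinite.f (normal_prob m s) leb)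
    (EFin \o normal_pdf m s).
  apply: integral_ae_eq => //.
  - exact: Radon_Nikodym_SigmaFinite.f_integrable.
  - by apply/measurable_EFinP; exact: measurable_normal_pdf.
  - by move=> E _ mE; rewrite -Radon_Nikodym_SigmaFinite.f_integral.
apply: ae_eq_integral => //.
- apply: emeasurable_funM => //.
  apply: measurable_int (Radon_Nikodym_SigmaFinite.f_integrable dom).
- apply: emeasurable_funM => //.
  by apply/measurable_EFinP; exact: measurable_normal_pdf.
- exact: ae_eqe_mul2l.
Qed.

(** The density of twice the deviation has half the peak but a slower decay; the surplus factor
    exp(-u), with u = 3 y^2 / (8 s^2), absorbs y^4 since u^2 <= exp u. As the wider density
    integrates to 1, the fourth moment is bounded without being computed. *)
Lemma normal_pdf_fourth_moment_le (m s x : R) : s != 0 ->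
  (x - m) ^+ 4 * normal_pdf m s x <= 32 * s ^+ 4 * normal_pdf m (2 * s) x.
Proof.
move=> s0; have s20 : 2 * s != 0 by rewrite mulf_neq0.
rewrite !normal_pdfE//=.
set y := x - m.
have pe : normal_peak (2 * s) = normal_peak s / 2.
  rewrite /normal_peak.
  have -> : (2 * s) ^+ 2 * pi *+ 2 = 2 ^+ 2 * (s ^+ 2 * pi *+ 2) by ring.
  by rewrite sqrtrM ?sqr_ge0// sqrtr_sqr ger0_norm// invfM mulrC.
rewrite pe /normal_fun -/y.
have sq0 : 0 < s ^+ 2 by rewrite exprn_even_gt0.
set u := 3 * y ^+ 2 / (8 * s ^+ 2).
have u0 : 0 <= u by rewrite divr_ge0// mulr_ge0// sqr_ge0.
have -> : - y ^+ 2 / (s ^+ 2 *+ 2) = - y ^+ 2 / ((2 * s) ^+ 2 *+ 2) + - u.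
  by rewrite /u; field.
rewrite expRD mulrCA mulrA.
have y4 : y ^+ 4 = 64 / 9 * s ^+ 4 * u ^+ 2 by rewrite /u; field.
have hu := sqr_le_expR u0.
have key : y ^+ 4 * expR (- u) <= 16 * s ^+ 4.
  rewrite expRN ler_pdivrMr ?expR_gt0// y4.
  have : 0 <= s ^+ 4 by rewrite exprn_even_ge0.
  by move: hu (expR_gt0 u); move: (expR u) (s ^+ 4) (u ^+ 2) => a b c; nra.
have p0 := normal_peak_gt0 s0.
set E := expR (- y ^+ 2 / _).
have E0 : 0 < E by rewrite expR_gt0.
have -> : normal_peak s * y ^+ 4 * (E * expR (- u))
   = (normal_peak s * E) * (y ^+ 4 * expR (- u)) by ring.
have -> : 32 * s ^+ 4 * (normal_peak s / 2 * E) =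
  (normal_peak s * E) * (16 * s ^+ 4) by field.
by rewrite ler_wpM2l// mulr_ge0// ltW.
Qed.

Lemma normal_prob_fourth_moment_le (m s : R) : s != 0 ->
  (\int[normal_prob m s]_x ((x - m) ^+ 4)%:E <= (32 * s ^+ 4)%:E)%E.
Proof.
move=> s0.
have m4 : measurable_fun setT (fun x : R => (x - m) ^+ 4).
  by apply: measurable_funX; exact: measurable_funB.
rewrite integral_normal_prob//; first last.
- exact/measurable_EFinP.
- by move=> x; rewrite lee_fin exprn_even_ge0.
apply: (@le_trans _ _
  (\int[leb]_x ((32 * s ^+ 4)%:E * (normal_pdf m (2 * s) x)%:E)))%E.
  apply: ge0_le_integral => //.
  - by move=> x _; rewrite -EFinM lee_fin mulr_ge0 ?normal_pdf_ge0// exprn_even_ge0.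
  - apply: emeasurable_funM; first exact/measurable_EFinP.
    by apply/measurable_EFinP; exact: measurable_normal_pdf.
  - apply: emeasurable_funM => //.
    by apply/measurable_EFinP; exact: measurable_normal_pdf.
  - by move=> x _; rewrite -!EFinM lee_fin normal_pdf_fourth_moment_le.
rewrite ge0_integralZl//; first last.
- by rewrite lee_fin mulr_ge0// exprn_even_ge0.
- by move=> x _; rewrite lee_fin normal_pdf_ge0.
- by apply/measurable_EFinP; exact: measurable_normal_pdf.
by rewrite integral_normal_pdf mule1.
Qed.

(** Whatever the mean, the probability is at most the peak 1 / sqrt(2 pi s^2) times the length |s|
    of the interval, and pi >= 2 gives sqrt(2 pi) >= 2. *)
Lemma normal_prob_near0_le (m s : R) : s != 0 ->
  (normal_prob m s [set x | (`|x| < `|s| / 2)%R] <= (2^-1)%:E)%E.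
Proof.
move=> s0; have s1 : 0 < `|s| by rewrite normr_gt0.
have -> : [set x | (`|x| < `|s| / 2)%R] = `](- (`|s| / 2)), (`|s| / 2)[%classic.
  by apply/seteqP; split => x /=; rewrite in_itv/= ltr_norml.
rewrite /normal_prob.
set A := `](- (`|s| / 2)), (`|s| / 2)[%classic.
have : (\int[leb]_(x in A) (normal_pdf m s x)%:E
    <= \int[leb]_(x in A) (normal_peak s)%:E)%E.
  apply: ge0_le_integral => //.
  - exact: measurable_itv.
  - by move=> x _; rewrite lee_fin normal_pdf_ge0.
  - by apply: measurable_funTS; apply/measurable_EFinP; exact: measurable_normal_pdf.
  - by move=> x _; rewrite lee_fin normal_pdf_ub.
have lA : leb A = `|s|%:E.
  rewrite /A lebesgue_measure_itv/= lte_fin ifT; last by lra.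
  by rewrite -EFinB; congr EFin; lra.
move=> /le_trans; apply; rewrite integral_cst; last exact: measurable_itv.
apply: (@le_trans _ _ ((normal_peak s)%:E * leb A)%E); first exact: lexx.
rewrite lA.
rewrite -EFinM lee_fin /normal_peak.
have h : 2 * `|s| <= Num.sqrt (s ^+ 2 * pi *+ 2).
  rewrite -[2 * _]ger0_norm ?mulr_ge0// -sqrtr_sqr; apply: ler_wsqrtr.
  rewrite exprMn real_normK ?num_real//.
  have := pi_ge2 R; have : 0 < s ^+ 2 by rewrite exprn_even_gt0.
  by rewrite -mulr_natr; nra.
have q0 : 0 < Num.sqrt (s ^+ 2 * pi *+ 2) by apply: lt_le_trans h; lra.
rewrite mulrC ler_pdivrMr//; lra.
Qed.

End gaussian_moments.

Section gaussian_fourth_moment.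
Context (R : realType) d (T : measurableType d) (P : probability T R).

(* The parameters m and s are not computed from the moments: s^2 is controlled by
   the second moment since X avoids ]-|s|/2, |s|/2[ with probability at least
   1/2, and then m^2 since X - m is of order s. *)
Lemma gaussian_fourth_moment : exists2 C : R, 1 <= C &
  forall (X : T -> R) (v : R), gaussian P X ->
  (\int[P]_w (X w ^+ 2)%:E = v%:E)%E ->
  (\int[P]_w (X w ^+ 4)%:E <= (C * v ^+ 2)%:E)%E.
Proof.
have K1 : (1 : R) <= 1 + 8 * 32 * 8 ^+ 2 + 8 * 274 ^+ 2.
  move: (sqr_ge0 (8 : R)) (sqr_ge0 (274 : R)).
  by move: (8 ^+ 2) (274 ^+ 2) => a b; lra.
(* From X^4 <= 8 (X - m)^4 + 8 m^4, E (X - m)^4 <= 32 s^4, s^2 <= 8 v and m^2 <= 274 v. *)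
exists (1 + 8 * 32 * 8 ^+ 2 + 8 * 274 ^+ 2).
  exact: K1.
move=> X v [mX [m [s PX]]] Xv.
have mXk k : measurable_fun setT (fun w => (X w ^+ k)%:E).
  by apply/measurable_EFinP; exact: measurable_funX.
have mXmk k : measurable_fun setT (fun w => ((X w - m) ^+ k)%:E).
  by apply/measurable_EFinP; apply: measurable_funX; exact: measurable_funB.
have v0 : 0 <= v by rewrite -lee_fin -Xv integral_ge0// => w _; rewrite lee_fin sqr_ge0.
(* In the degenerate case X = m almost surely, and C >= 1 is enough. *)
have [s0|s0] := eqVneq s 0.
  have Xm : {ae P, forall w, X w = m}.
    exists (X @^-1` (~` [set m])); split.
    - by rewrite -[X in measurable X]setTI; apply: mX => //; exact: measurableC.
    - have := PX _ (measurableC (measurable_set1 m)); rewrite s0 eqxx => ->.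
      by rewrite diracE memNset//= => /(_ erefl).
    - by move=> w /= h.
  have Ek k : (\int[P]_w (X w ^+ k)%:E = (m ^+ k)%:E)%E.
    rewrite (@ae_eq_integral _ _ _ _ _ (fun=> (m ^+ k)%:E))//.
      by rewrite integral_cst//= probability_setT mule1.
    by apply: filterS Xm => w -> _.
  move: Xv; rewrite !Ek => -[<-]; rewrite lee_fin.
  by rewrite -exprM ler_peMl// exprn_even_ge0.
have {PX}PX C : measurable C -> P (X @^-1` C) = normal_prob m s C.
  by move=> mC; rewrite PX// (negbTE s0).
have m4 : (\int[P]_w ((X w - m) ^+ 4)%:E <= (32 * s ^+ 4)%:E)%E.
  apply: le_trans (normal_prob_fourth_moment_le m s0).
  have mX' : measurable_fun setT (X : T -> measurableTypeR R) by [].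
  pose Y : {RV P >-> measurableTypeR R} :=
    HB.pack X (isMeasurableFun.Build _ _ T (measurableTypeR R) X mX').
  have -> : (\int[normal_prob m s]_x ((x - m) ^+ 4)%:E =
      \int[distribution P Y]_x ((x - m) ^+ 4)%:E)%E.
    apply: eq_measure_integral => A mA _. exact: esym (PX A mA).
  rewrite ge0_integral_distribution//.
  - by apply/measurable_EFinP; apply: measurable_funX; exact: measurable_funB.
  - by move=> x; rewrite lee_fin exprn_even_ge0.
have sq0 : 0 < s ^+ 2 by rewrite exprn_even_gt0.
(* The second moment is read off the fourth by y^2 <= s^2 / 2 + y^4 / (2 s^2): this gives 1/2 + 16
   <= 17. *)
have m2 : (\int[P]_w ((X w - m) ^+ 2)%:E <= (17 * s ^+ 2)%:E)%E.
  apply: (@le_trans _ _ (\int[P]_w ((s ^+ 2 / 2)%:E + ((2 * s ^+ 2)^-1)%:E * ((X w - m) ^+ 4)%:E)))%E.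
    apply: ge0_le_integral => //.
    - by move=> w _; rewrite lee_fin sqr_ge0.
    - by apply: emeasurable_funD => //; exact: emeasurable_funM.
    - move=> w _; rewrite -EFinM -EFinD lee_fin.
      have -> : s ^+ 2 / 2 + (2 * s ^+ 2)^-1 * (X w - m) ^+ 4 =
          (X w - m) ^+ 2 + (s ^+ 2 - (X w - m) ^+ 2) ^+ 2 / (2 * s ^+ 2) by field.
      by rewrite lerDl divr_ge0 ?sqr_ge0// mulr_ge0// ltW.
  rewrite ge0_integralD//; first last.
  - exact: emeasurable_funM.
  - by move=> w _; rewrite -EFinM lee_fin mulr_ge0 ?invr_ge0 ?exprn_even_ge0// mulr_ge0// ltW.
  - by move=> w _; rewrite lee_fin divr_ge0// ltW.
  rewrite integral_cst//= probability_setT mule1 ge0_integralZl//; first last.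
  - by rewrite lee_fin invr_ge0 mulr_ge0// ltW.
  - by move=> w _; rewrite lee_fin exprn_even_ge0.
  apply: (@le_trans _ _ ((s ^+ 2 / 2)%:E + ((2 * s ^+ 2)^-1)%:E * (32 * s ^+ 4)%:E))%E.
    by rewrite leeD2l// lee_wpmul2l// lee_fin invr_ge0 mulr_ge0// ltW.
  rewrite -EFinM -EFinD lee_fin.
  have -> : s ^+ 2 / 2 + (2 * s ^+ 2)^-1 * (32 * s ^+ 4) = 33 / 2 * s ^+ 2 by field.
  by nra.
(* As in Markov's inequality: X^2 >= s^2 / 4 on an event of probability at least 1/2. *)
have s2v : s ^+ 2 <= 8 * v.
  have mA : measurable [set x : R | `|x| < `|s| / 2].
    have -> : [set x | (`|x| < `|s| / 2)%R] = `](- (`|s| / 2)), (`|s| / 2)[%classic.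
      by apply/seteqP; split => x /=; rewrite in_itv/= ltr_norml.
    exact: measurable_itv.
  set A := X @^-1` (~` [set x : R | `|x| < `|s| / 2]).
  have mA' : measurable A by rewrite /A -[X in measurable X]setTI; apply: mX => //; exact: measurableC.
  have PA : (2^-1%:E <= P A)%E.
    rewrite /A PX; last exact: measurableC.
    rewrite [leRHS]probability_setC//.
    rewrite leeBrDr ?fin_num_measure//.
    apply: le_trans (leeD2l _ (normal_prob_near0_le m s0)) _.
    by rewrite -EFinD lee_fin; lra.
  have : ((s ^+ 2 / 4)%:E * P A <= v%:E)%E.
    rewrite -Xv -[A in P A]setIT -integral_indic//.
    rewrite -ge0_integralZl//; first last.
    - by rewrite lee_fin divr_ge0// ltW.
    - by apply/measurable_EFinP; exact: measurable_indic.
    apply: ge0_le_integral => //.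
    - by move=> w _; rewrite -EFinM lee_fin mulr_ge0// divr_ge0// ltW.
    - by apply: emeasurable_funM => //; apply/measurable_EFinP; exact: measurable_indic.
    - move=> w _; rewrite -EFinM lee_fin indicE.
      have [wA|wA] := boolP (w \in A); rewrite ?mulr0 ?sqr_ge0// mulr1.
      move: wA; rewrite inE /A/= => /negP; rewrite -leNgt => h.
      rewrite -[leRHS]real_normK ?num_real//.
      have -> : s ^+ 2 / 4 = (`|s| / 2) ^+ 2 by rewrite exprMn real_normK ?num_real//; field.
      by rewrite lerXn2r// nnegrE divr_ge0.
  have : ((s ^+ 2 / 8)%:E <= (s ^+ 2 / 4)%:E * P A)%E.
    apply: (@le_trans _ _ ((s ^+ 2 / 4)%:E * 2^-1%:E)%E).
      by rewrite -EFinM lee_fin; lra.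
    by rewrite lee_pmul2l// lte_fin divr_gt0.
  by move=> h1 h2; have := le_trans h1 h2; rewrite lee_fin; lra.
(* Integrating m^2 <= 2 X^2 + 2 (X - m)^2 gives 2 v + 34 s^2, at most (2 + 34 * 8) v. *)
have m2v : m ^+ 2 <= 274 * v.
  have : ((m ^+ 2)%:E <= 2%:E * v%:E + 2%:E * (17 * s ^+ 2)%:E)%E.
    apply: (@le_trans _ _ (\int[P]_w (2%:E * (X w ^+ 2)%:E + 2%:E * ((X w - m) ^+ 2)%:E)))%E.
      rewrite -[leLHS]mule1 -(@probability_setT _ _ _ P) -integral_cst//.
      apply: ge0_le_integral => //.
      - by move=> w _; rewrite lee_fin sqr_ge0.
      - by apply: emeasurable_funD; exact: emeasurable_funM.
      - move=> w _; rewrite -!EFinM -EFinD lee_fin.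
        by have := sqr_ge0 (2 * X w - m); nra.
    rewrite ge0_integralD//; first last.
    - exact: emeasurable_funM.
    - by move=> w _; rewrite -EFinM lee_fin mulr_ge0// sqr_ge0.
    - exact: emeasurable_funM.
    - by move=> w _; rewrite -EFinM lee_fin mulr_ge0// sqr_ge0.
    rewrite !ge0_integralZl//; try by move=> w _; rewrite lee_fin sqr_ge0.
    by rewrite Xv leeD2l// lee_wpmul2l// lee_fin.
  by rewrite -!EFinM -EFinD lee_fin; lra.
apply: (@le_trans _ _ (\int[P]_w (8%:E * ((X w - m) ^+ 4)%:E + (8 * m ^+ 4)%:E)))%E.
  apply: ge0_le_integral => //.
  - by move=> w _; rewrite lee_fin exprn_even_ge0.
  - by apply: emeasurable_funD => //; exact: emeasurable_funM.
  - move=> w _; rewrite -EFinM -EFinD lee_fin.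
    set y := X w - m; have -> : X w = y + m by rewrite /y subrK.
    apply: (@le_trans _ _ ((2 * (y ^+ 2 + m ^+ 2)) ^+ 2)).
      rewrite -[4%N]/(2 * 2)%N exprM lerXn2r// ?nnegrE ?sqr_ge0//.
        by rewrite mulr_ge0// addr_ge0 ?sqr_ge0.
      by have := sqr_ge0 (y - m); nra.
    by have := sqr_ge0 (y ^+ 2 - m ^+ 2); nra.
rewrite ge0_integralD//; first last.
- by move=> w _; rewrite lee_fin mulr_ge0// exprn_even_ge0.
- exact: emeasurable_funM.
- by move=> w _; rewrite -EFinM lee_fin mulr_ge0// exprn_even_ge0.
rewrite integral_cst//= probability_setT mule1 ge0_integralZl//; last first.
  by move=> w _; rewrite lee_fin exprn_even_ge0.
apply: (@le_trans _ _ (8%:E * (32 * s ^+ 4)%:E + (8 * m ^+ 4)%:E))%E.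
  by rewrite leeD2r// lee_wpmul2l// lee_fin.
rewrite -EFinM -EFinD lee_fin.
have pow4 (a b : R) : a ^+ 2 <= b * v -> 0 <= b -> a ^+ 4 <= b ^+ 2 * v ^+ 2.
  move=> ab b0; rewrite -exprMn -[4%N]/(2 * 2)%N exprM.
  by rewrite lerXn2r// nnegrE ?sqr_ge0// mulr_ge0.
have h1 := pow4 _ _ s2v (ler0n _ _); have h2 := pow4 _ _ m2v (ler0n _ _).
move: h1 h2 (sqr_ge0 v); move: (s ^+ 4) (m ^+ 4) (v ^+ 2) (274 ^+ 2) (8 ^+ 2).
by clear=> a b c e f; lra.
Qed.

End gaussian_fourth_moment.

(** By Fatou the lower limit of (U - S_n)^4 has integral 0, and where S_n converges to V this lower
    limit is (U - V)^4. No subsequence has to be extracted, and V comes without a measurability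
    proof. *)
Lemma ae_eq_of_cvg (R : realType) d (T : measurableType d)
    (P : probability T R) (U V : T -> R) (S : nat -> T -> R) :
  measurable_fun setT U -> (forall n, measurable_fun setT (S n)) ->
  {ae P, forall w, S n w @[n --> \oo] --> V w} ->
  (\int[P]_w ((U w - S n w) ^+ 4)%:E @[n --> \oo] --> 0)%E ->
  {ae P, forall w, U w = V w}.
Proof.
move=> mU mS SV intS.
pose f n w := ((U w - S n w) ^+ 4)%:E.
have mf n : measurable_fun setT (f n).
  by apply/measurable_EFinP; apply: measurable_funX; exact: measurable_funB.
have f0 n w : (0 <= f n w)%E by rewrite lee_fin exprn_even_ge0.
have := fatou P measurableT mf (fun n w _ => f0 n w).
have -> : limn_einf (fun n => \int[P]_w f n w)%E = 0%E.
  exact: (cvg_limn_einf_sup intS).1.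
move=> le0.
have g0 w : (0 <= limn_einf (f ^~ w))%E.
  rewrite limn_einf_lim; apply: lime_ge; first exact: is_cvg_einfs.
  by apply: nearW => n; apply: le_ereal_inf_tmp => _ [k _ <-].
have mg : measurable_fun setT (fun w => limn_einf (f ^~ w)).
  apply: (emeasurable_fun_cvg (fun n w => einfs (f ^~ w) n)).
    exact: measurable_fun_einfs.
  move=> w _ /=.
  by rewrite limn_einf_lim; exact: is_cvg_einfs.
have /(ae_eq_integral_abs P measurableT mg) : (\int[P]_w `|limn_einf (f ^~ w)| = 0)%E.
  apply/eqP; rewrite eq_le integral_ge0// andbT.
  by under eq_integral do rewrite gee0_abs//.
move=> gae; move: SV gae; apply: filterS2 => w SV /(_ I)/= .
have : f n w @[n --> \oo] --> ((U w - V w) ^+ 4)%:E.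
  apply: cvg_EFin; first by near=> n.
  apply: (cvg_comp (fun n => U w - S n w) (fun y => y ^+ 4)).
    by apply: cvgB; [exact: cvg_cst|exact: SV].
  exact: exprn_continuous.
move=> /cvg_limn_einf_sup [-> _] [] /eqP; rewrite expf_eq0/= subr_eq0 => /eqP //.
Unshelve. all: by end_near. Qed.

(** * Dyadic chaining *)

(* The grid of step 2^-m is only used on k / 2^m with |k| <= 3^m: it still
   exhausts the line as m grows, so that one sum over m and k controls the
   whole path. *)
Definition in_range (R : realType) (t : R) (m : nat) : bool :=
  `|t| + 1 <= (3 / 2) ^+ m.

Section dyadic_chaining.
Context (R : realType) (rho : R) (rho_gt0 : 0 < rho) (rho_lt1 : rho < 1).

Definition dyadic_floor (m : nat) (t : R) : R :=
  (Num.floor (2 ^+ m * t))%:~R / 2 ^+ m.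

Definition dyadic_limit (x : R -> R) (t : R) : R :=
  limn (fun m => x (dyadic_floor m t)).

Variables (x : R -> R) (h : R).
Hypothesis x0_le : `|x 0| <= h.
Hypothesis increment_le : forall (m : nat) (k : int), `|k%:~R : R| <= 3 ^+ m ->
  `|x ((k + 1)%:~R / 2 ^+ m) - x (k%:~R / 2 ^+ m)| <= h * rho ^+ m.

Let h_ge0 : 0 <= h. Proof. exact: le_trans x0_le. Qed.
Local Notation c := ((1 - rho)^-1).

Let c_ge0 : 0 <= c. Proof. by rewrite invr_ge0 subr_ge0 ltW. Qed.


Implicit Types (s t : R) (m : nat).

Let pow32 m : 2 ^+ m * (3 / 2) ^+ m = 3 ^+ m :> R.
Proof. by rewrite -exprMn; congr (_ ^+ _); field. Qed.

Let floorP (y : R) :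
  (Num.floor y)%:~R <= y /\ y < (Num.floor y)%:~R + 1.
Proof. by have /andP[-> +] := floor_itv y; rewrite intrD. Qed.

Let floor_bound t m : in_range t m -> `|(Num.floor (2 ^+ m * t))%:~R : R| <= 3 ^+ m.
Proof.
rewrite /in_range => tm; have p2 : (1 : R) <= 2 ^+ m by rewrite exprn_ege1// ler1n.
have [f1 f2] := floorP (2 ^+ m * t).
have : `|2 ^+ m * t| + 2 ^+ m <= 3 ^+ m.
  rewrite -pow32 normrM [`|2 ^+ m|]ger0_norm ?exprn_ge0//.
  by rewrite -[X in _ + X]mulr1 -mulrDr ler_wpM2l ?exprn_ge0.
move: f1 f2 p2; set a : R := (Num.floor _)%:~R; move: (2 ^+ m) a (2 ^+ m * t) => e a b.
rewrite ler_norml => ? ? ? ?; have := ler_norm b; have := ler_norm (- b).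
by rewrite normrN => ? ?; apply/andP; split; lra.
Qed.

Let in_rangeS t m : in_range t m -> in_range t m.+1.
Proof.
rewrite /in_range => /le_trans; apply; by rewrite exprS ler_peMl//; lra.
Qed.

Let in_rangeD t m j : in_range t m -> in_range t (m + j).
Proof. by move=> tm; elim: j => [|j]; rewrite ?addn0// addnS; exact: in_rangeS. Qed.

(** Refining the grid either keeps the point below t or moves it to the next grid point, so at most
    one increment of level m+1 is involved. *)
Lemma dyadic_floor_step t m : in_range t m ->
  `|x (dyadic_floor m.+1 t) - x (dyadic_floor m t)| <= h * rho ^+ m.+1.
Proof.
move=> tm; set k := Num.floor (2 ^+ m * t).
have p2 : (0 : R) < 2 ^+ m by rewrite exprn_gt0.
have e1 : dyadic_floor m t = (2 * k)%:~R / 2 ^+ m.+1.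
  rewrite /dyadic_floor -/k intrM exprS; field; lra.
have k3 : `|(2 * k)%:~R : R| <= 3 ^+ m.+1.
  rewrite intrM normrM exprS ger0_norm// ler_pM//; first lra.
  exact: floor_bound.
have fE : Num.floor (2 ^+ m.+1 * t) = 2 * k \/
    Num.floor (2 ^+ m.+1 * t) = 2 * k + 1.
  have [f1 f2] := floorP (2 ^+ m * t).
  rewrite exprS -mulrA; have [lt|ge] := ltP (2 * (2 ^+ m * t)) (2 * k + 1)%:~R.
    left; apply/eqP; rewrite floor_eq; apply/andP; split => //.
    by rewrite intrM; lra.
  right; apply/eqP; rewrite floor_eq; apply/andP; split => //.
  by rewrite !intrD intrM; lra.
rewrite e1 /dyadic_floor; case: fE => ->; last exact: increment_le.
by rewrite subrr normr0 mulr_ge0// exprn_ge0// ltW.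
Qed.

Lemma dyadic_floor_chain t m j : in_range t m ->
  `|x (dyadic_floor (m + j) t) - x (dyadic_floor m t)| <= c * h * rho ^+ m.
Proof.
move=> tm.
(* The induction on j needs the exact partial sum of the geometric series as its bound. *)
apply: (@le_trans _ _ (c * h * (rho ^+ m - rho ^+ (m + j)))); last first.
  by rewrite ler_wpM2l ?mulr_ge0// gerBl exprn_ge0// ltW.
elim: j => [|j IH]; first by rewrite addn0 !subrr normr0 mulr0.
rewrite addnS.
have := dyadic_floor_step (in_rangeD j tm).
have cE : h * rho ^+ (m + j).+1 <= c * h * (rho ^+ (m + j) - rho ^+ (m + j).+1).
  have -> : c * h * (rho ^+ (m + j) - rho ^+ (m + j).+1) = h * rho ^+ (m + j).
    by rewrite exprS; field; rewrite subr_eq0 gt_eqF.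
  by rewrite exprS ler_wpM2l// ler_piMl ?exprn_ge0// ltW.
move=> st.
have := ler_distD (x (dyadic_floor (m + j) t)) (x (dyadic_floor (m + j).+1 t))
  (x (dyadic_floor m t)).
lra.
Qed.

Lemma in_range_exists t : exists m, in_range t m.
Proof.
have t0 : 0 < (`|t| + 1)^-1 by rewrite invr_gt0 ltr_wpDl.
have : (2 / 3 : R) ^+ n @[n --> \oo] --> (0 : R) by apply: cvg_expr; rewrite ger0_norm; lra.
move=> /cvgr0Pnorm_lt/(_ _ t0)[m _ /(_ m (leqnn m))] mP; exists m.
rewrite /in_range -[_ ^+ _]invrK -[leLHS]invrK lef_pV2 ?posrE ?invr_gt0 ?exprn_gt0//.
by rewrite -exprVn invf_div ltW// (le_lt_trans (ler_norm _)).
Qed.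

Lemma dyadic_limit_cvg t : x (dyadic_floor m t) @[m --> \oo] --> dyadic_limit x t.
Proof.
have [m0 tm0] := in_range_exists t.
suff : cvgn (fun m => x (dyadic_floor m t)) by [].
apply/cauchy_cvgP/cauchy_exP => e e0.
have /cvgr0Pnorm_lt/(_ e e0)[m1 _ m1P] : c * h * rho ^+ m @[m --> \oo] --> (0 : R).
  rewrite -[X in _ --> X](mulr0 (c * h)); apply: cvgMr; apply: cvg_expr.
  by rewrite ger0_norm ?ltW.
pose m := maxn m0 m1; exists (x (dyadic_floor m t)); exists m => // n /= mn.
rewrite -ball_normE/= distrC -(subnKC mn).
apply: le_lt_trans (dyadic_floor_chain _ _) _.
  by rewrite /m -(subnKC (leq_maxl m0 m1)); exact: in_rangeD.
by apply: le_lt_trans (ler_norm _) (m1P _ _); rewrite /= leq_maxr.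
Qed.

Lemma dyadic_limit_dist t m : in_range t m ->
  `|dyadic_limit x t - x (dyadic_floor m t)| <= c * h * rho ^+ m.
Proof.
move=> tm.
have : `|x (dyadic_floor n t) - x (dyadic_floor m t)| @[n --> \oo] -->
    `|dyadic_limit x t - x (dyadic_floor m t)|.
  by apply: cvg_norm; apply: cvgB; [exact: dyadic_limit_cvg|exact: cvg_cst].
move=> /cvg_lim <-//; apply: limr_le.
  by apply/cvg_ex; eexists; apply: cvg_norm; apply: cvgB;
    [exact: dyadic_limit_cvg|exact: cvg_cst].
exists m => // n /= mn; rewrite -(subnKC mn); exact: dyadic_floor_chain.
Qed.

(** Points at distance at most 2^-m have equal or adjacent grid points below them. The constant
    counts two passages to the limit, each costing 1 / (1 - rho), and one increment. *)
Lemma dyadic_limit_modulus s t m :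
  `|s| + 1 <= (3 / 2) ^+ m -> `|t| + 1 <= (3 / 2) ^+ m ->
  `|s - t| <= (2 ^+ m)^-1 ->
  `|dyadic_limit x s - dyadic_limit x t| <= (2 / (1 - rho) + 1) * h * rho ^+ m.
Proof.
wlog st : s t / s <= t.
  move=> H sm tm st; have [le|/ltW le] := leP s t; first exact: H.
  by rewrite distrC; apply: H => //; rewrite distrC.
move=> sm tm std.
suff key : `|x (dyadic_floor m s) - x (dyadic_floor m t)| <= h * rho ^+ m.
  have := dyadic_limit_dist sm; have := dyadic_limit_dist tm.
  have := ler_distD (x (dyadic_floor m s)) (dyadic_limit x s) (dyadic_limit x t).
  have := ler_distD (x (dyadic_floor m t)) (x (dyadic_floor m s)) (dyadic_limit x t).
  rewrite (distrC (x (dyadic_floor m t)) (dyadic_limit x t)); lra.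
have p2 : (0 : R) < 2 ^+ m by rewrite exprn_gt0.
have hrho : 0 <= h * rho ^+ m by rewrite mulr_ge0// exprn_ge0// ltW.
have [f1 f2] := floorP (2 ^+ m * s).
have [g1 g2] := floorP (2 ^+ m * t).
have ts1 : 2 ^+ m * t <= 2 ^+ m * s + 1.
  move: std; rewrite distrC ger0_norm ?subr_ge0// lerBlDl -(ler_pM2l p2) mulrDr.
  by rewrite divff ?gt_eqF// addrC.
have ts0 : 2 ^+ m * s <= 2 ^+ m * t by rewrite ler_pM2l.
rewrite /dyadic_floor.
have k3 := floor_bound sm.
move: f1 f2 g1 g2 k3; set k := Num.floor (2 ^+ m * s); set l := Num.floor (2 ^+ m * t).
move=> f1 f2 g1 g2 k3.
have : k <= l <= k + 1.
  rewrite -!ltzD1 -!(ltr_int R) !intrD !mulr1z; apply/andP; split; lra.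
have [->|nlk] := eqVneq l k; first by rewrite subrr normr0.
move=> /andP[kl lk].
have -> : l = k + 1.
  by apply/eqP; rewrite eq_le lk/= -ltzD1 ltrD2r lt_neqAle kl eq_sym nlk.
by rewrite distrC; exact: increment_le.
Qed.

(** The point is reached from 0 in |k| grid steps of cost at most h each; the bound is crude, but m
    is fixed where it is used. *)
Lemma grid_value_le m (k : int) : `|k%:~R : R| <= 3 ^+ m ->
  `|x (k%:~R / 2 ^+ m)| <= h * (1 + 3 ^+ m).
Proof.
move=> k3; apply: (@le_trans _ _ (h * (1 + `|k%:~R : R|))); last first.
  by rewrite ler_wpM2l// lerD2l.
have rm1 : h * rho ^+ m <= h by rewrite ler_piMr// exprn_ile1// ltW.
have step (j : int) : `|j%:~R : R| <= 3 ^+ m ->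
    `|x ((j + 1)%:~R / 2 ^+ m) - x (j%:~R / 2 ^+ m)| <= h.
  by move=> jm; apply: le_trans (increment_le jm) rm1.
(* For negative k the walk goes left, and the increment used is the one that starts at the new
   point. *)
case: k k3 => n; rewrite ?NegzE.
  elim: n => [|n IH] n3; first by rewrite mul0r normr0 addr0 mulr1.
  have n3' : `|(Posz n)%:~R : R| <= 3 ^+ m.
    by apply: le_trans n3; rewrite !ger0_norm ?ler0n// ler_nat.
  have := step _ n3'; have := IH n3'.
  have -> : Posz n + 1 = Posz n.+1 by rewrite -addn1 PoszD.
  have -> : `|(Posz n.+1)%:~R : R| = `|(Posz n)%:~R : R| + 1.
    by rewrite !ger0_norm ?ler0n// -addn1 PoszD intrD.
  move=> a b; have := ler_distD 0 (x ((Posz n.+1)%:~R / 2 ^+ m)) (x ((Posz n)%:~R / 2 ^+ m)).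
  have := lerB_dist (x ((Posz n.+1)%:~R / 2 ^+ m)) (x ((Posz n)%:~R / 2 ^+ m)).
  lra.
elim: n.+1 => [|{}n IH] n3; first by rewrite oppr0 mul0r normr0 addr0 mulr1.
have n3' : `|(- Posz n)%:~R : R| <= 3 ^+ m.
  apply: le_trans n3; rewrite !mulrNz !normrN !ger0_norm ?ler0n//.
  by rewrite ler_nat.
have := step _ n3; have := IH n3'.
have -> : - Posz n.+1 + 1 = - Posz n by rewrite -addn1 PoszD opprD subrK.
have -> : `|(- Posz n.+1)%:~R : R| = `|(- Posz n)%:~R : R| + 1.
  by rewrite !mulrNz !normrN !ger0_norm ?ler0n// -addn1 PoszD intrD.
move=> a; rewrite distrC => b.
have := lerB_dist (x ((- Posz n.+1)%:~R / 2 ^+ m)) (x ((- Posz n)%:~R / 2 ^+ m)).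
lra.
Qed.

Lemma dyadic_limit_le t m : `|t| + 1 <= (3 / 2) ^+ m ->
  `|dyadic_limit x t| <= (1 + 3 ^+ m + (1 - rho)^-1) * h.
Proof.
move=> tm; have := dyadic_limit_dist tm.
have := grid_value_le (floor_bound tm); rewrite -/(dyadic_floor m t).
have : c * h * rho ^+ m <= c * h.
  by rewrite ler_piMr ?mulr_ge0// exprn_ile1// ltW.
have := lerB_dist (dyadic_limit x t) (x (dyadic_floor m t)).
lra.
Qed.

End dyadic_chaining.

(** * Continuous versions in weighted sequence spaces *)

Lemma nneseries_le_bound (R : realType) (u : nat -> \bar R) (M : \bar R) :
  (forall n, 0 <= u n)%E -> (forall n, \sum_(0 <= k < n) u k <= M)%E ->
  (\sum_(n <oo) u n <= M)%E.
Proof.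
move=> u0 uM; apply: lime_le; first by apply: is_cvg_nneseries => *; exact: u0.
exact: nearW.
Qed.

Section weighted_paths.
Context (R : realType) d (T : measurableType d) (P : probability T R).
Variables (X : nat -> R -> T -> R) (mu : nat -> R) (C : R).
Hypothesis mX : forall n t, measurable_fun setT (X n t).
Hypothesis mu_ge0 : forall n, 0 <= mu n.
Hypothesis mu_sum : (\sum_(n <oo) (mu n)%:E < +oo)%E.
Hypothesis X0_le : forall n, (\int[P]_w (X n 0 w ^+ 4)%:E <= C%:E)%E.
Hypothesis XB_le : forall n s t,
  (\int[P]_w ((X n s w - X n t w) ^+ 4)%:E <= (C * (s - t) ^+ 2)%:E)%E.
Hypothesis X_mu0 : forall n t w, mu n = 0 -> X n t w = 0.

Let C_ge0 : 0 <= C.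
Proof.
by rewrite -lee_fin; apply: le_trans (X0_le 0); apply: integral_ge0 => w _;
  rewrite lee_fin exprn_even_ge0.
Qed.

Let pow4V m : (4^-1 : R) ^+ m = ((2 ^+ m)^-1) ^+ 2.
Proof. by rewrite -exprVn -exprM mulnC exprM; congr (_ ^+ _); field. Qed.

Let incr n m (k : int) (w : T) : R :=
  (X n ((k + 1)%:~R / 2 ^+ m) w - X n (k%:~R / 2 ^+ m) w) ^+ 4.

Let incr_ge0 n m k w : 0 <= incr n m k w. Proof. exact: exprn_even_ge0. Qed.

Let mincr n m k : measurable_fun setT (fun w => (incr n m k w)%:E).
Proof.
by apply/measurable_EFinP; apply: measurable_funX; exact: measurable_funB.
Qed.

Let int_incr n m k : (\int[P]_w (incr n m k w)%:E <= (C * (4^-1) ^+ m)%:E)%E.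
Proof.
apply: le_trans (XB_le _ _ _) _; rewrite lee_fin ler_wpM2l//.
by rewrite -mulrBl intrD mulr1z [_ + 1]addrC addrK mul1r pow4V.
Qed.

(* About 3^m increments of fourth moment of order 4^-m: with the weight (5/4)^m
   the expectations are dominated by a geometric series of ratio 15/16. *)
Let level n m (w : T) : \bar R := (((5 / 4) ^+ m)%:E *
  \sum_(i < (3 ^ m).+1) ((incr n m (Posz i) w)%:E + (incr n m (- Posz i) w)%:E))%E.

Let p54 m : 0 <= (5 / 4) ^+ m :> R.
Proof. by rewrite exprn_ge0// divr_ge0. Qed.

Let level_ge0 n m w : (0 <= level n m w)%E.
Proof.
by rewrite mule_ge0 ?lee_fin// sume_ge0// => i _; rewrite -EFinD lee_fin addr_ge0.
Qed.

Let mlevel n m : measurable_fun setT (level n m).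
Proof.
apply: emeasurable_funM => //; apply: emeasurable_sum => i.
exact: emeasurable_funD.
Qed.

(** Each of the 3^m + 1 pairs contributes at most 2 C 4^-m, and 2 (3^m + 1) <= 4 * 3^m. *)
Let int_level n m :
  (\int[P]_w level n m w <= (4 * C * (15 / 16) ^+ m)%:E)%E.
Proof.
rewrite ge0_integralZl ?lee_fin//; first last.
- by move=> w _; rewrite sume_ge0// => i _; rewrite -EFinD lee_fin addr_ge0.
- by apply: emeasurable_sum => i; exact: emeasurable_funD.
rewrite ge0_integral_sum//; first last.
- by move=> i w _; rewrite -EFinD lee_fin addr_ge0.
- by move=> i; exact: emeasurable_funD.
apply: (@le_trans _ _ (((5 / 4) ^+ m)%:E *
    (\sum_(i < (3 ^ m).+1) (2 * (C * (4^-1) ^+ m))%:E)))%E.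
  rewrite lee_wpmul2l ?lee_fin//; apply: lee_sum => i _.
  rewrite ge0_integralD//; try by move=> w _; rewrite lee_fin.
  by rewrite mulr_natl mulr2n EFinD; apply: leeD; exact: int_incr.
rewrite sumEFin sumr_const card_ord -EFinM lee_fin.
have -> : (15 / 16 : R) ^+ m = (5 / 4) ^+ m * 3 ^+ m * (4^-1) ^+ m.
  by rewrite -!exprMn; congr (_ ^+ _); field.
rewrite -[_ *+ (3 ^ m).+1]mulr_natr -[(3 ^ m).+1%:R]natr1 natrX.
have : (1 : R) <= 3 ^+ m by rewrite exprn_ege1// ler1n.
have : 0 <= (5 / 4) ^+ m * C * (4^-1) ^+ m by rewrite !mulr_ge0// exprn_ge0.
move: ((5 / 4) ^+ m) (3 ^+ m) ((4^-1) ^+ m) => a b e abe b1.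
have -> : a * (2 * (C * e) * (b + 1)) = (a * C * e) * (2 * b + 2) by ring.
have -> : 4 * C * (a * b * e) = (a * C * e) * (4 * b) by ring.
by rewrite ler_wpM2l//; lra.
Qed.

Let coord n (w : T) : \bar R :=
  ((X n 0 w ^+ 4)%:E + \sum_(m <oo) level n m w)%E.

Let coord_ge0 n w : (0 <= coord n w)%E.
Proof.
by rewrite adde_ge0 ?lee_fin ?exprn_even_ge0//; exact: nneseries_ge0.
Qed.

Let mX04 n : measurable_fun setT (fun w => (X n 0 w ^+ 4)%:E).
Proof. by apply/measurable_EFinP; exact: measurable_funX. Qed.

Let mcoord n : measurable_fun setT (coord n).
Proof.
apply: emeasurable_funD => //.
by apply: (ge0_emeasurable_sum (P := xpredT)) => // k w _ _; exact: level_ge0.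
Qed.

(** The geometric series of ratio 15/16 multiplies 4 C by 16, and the value at time 0 adds C. The
    bound is uniform in n, so the summable weights [mu] make [total] integrable. *)
Let int_coord n : (\int[P]_w coord n w <= (65 * C)%:E)%E.
Proof.
rewrite ge0_integralD//; first last.
- by apply: (ge0_emeasurable_sum (P := xpredT)) => // k w _ _; exact: level_ge0.
- by move=> w _; exact: nneseries_ge0.
- by move=> w _; rewrite lee_fin exprn_even_ge0.
have -> : 65 * C = C + 64 * C by ring.
rewrite EFinD leeD// integral_nneseries//.
apply: nneseries_le_bound => [k|k]; first by apply: integral_ge0.
apply: (@le_trans _ _ (\sum_(0 <= m < k) (4 * C * (15 / 16) ^+ m)%:E)%E).
  by apply: lee_sum => m _; exact: int_level.
rewrite sumEFin lee_fin.
apply: (@le_trans _ _ (64 * C * (1 - (15 / 16) ^+ k))); last first.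
  by rewrite ler_piMr ?mulr_ge0// gerBl exprn_ge0// divr_ge0.
elim: k => [|k IH]; first by rewrite big_nil subrr mulr0.
rewrite big_nat_recr//=; apply: le_trans (lerD IH (lexx _)) _.
by rewrite exprS le_eqVlt; apply/orP; left; apply/eqP; field.
Qed.

Let total (w : T) : \bar R := (\sum_(n <oo) (mu n)%:E * coord n w)%E.

Let mtotal : measurable_fun setT total.
Proof.
apply: (ge0_emeasurable_sum (P := xpredT)) => k.
  by move=> w _ _; rewrite mule_ge0// lee_fin.
by move=> _; exact: emeasurable_funM.
Qed.

Let total_ge0 w : (0 <= total w)%E.
Proof. by apply: nneseries_ge0 => n _ _; rewrite mule_ge0// lee_fin. Qed.

Let int_total : (\int[P]_w total w < +oo)%E.
Proof.
rewrite integral_nneseries//; first last.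
- by move=> n w _; rewrite mule_ge0// lee_fin.
- by move=> n; exact: emeasurable_funM.
apply: (@le_lt_trans _ _ ((65 * C)%:E * \sum_(n <oo) (mu n)%:E)%E).
  rewrite -nneseriesZl; last by move=> n _; rewrite lee_fin.
  apply: lee_nneseries => n.
    by move=> _ _; apply: integral_ge0 => w _; rewrite mule_ge0// lee_fin.
  move=> _; rewrite ge0_integralZl ?lee_fin// [leRHS]muleC.
  by rewrite lee_wpmul2l// lee_fin.
rewrite lte_mul_pinfty// ?lee_fin ?mulr_ge0//.
Qed.

Let good : set T := [set w | (total w < +oo)%E].

Let mgood : measurable good.
Proof. by rewrite -[good]setTI; exact: emeasurable_fun_infty_o. Qed.

Let good_ae : {ae P, forall w, good w}.
Proof.
have : P.-integrable setT total.
  apply/integrableP; split => //.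
  by under eq_integral do rewrite gee0_abs//.
move=> /(integrable_ae measurableT); apply: filterS => w /(_ I).
by rewrite /good/= fin_num_abs gee0_abs.
Qed.

(* As 4/5 <= (19/20)^4, the increments of level m are at most
   scale * (19/20)^m, and scale^2 <= 1 + scale^4 makes it summable. *)
Let scale n w : R := Num.sqrt (Num.sqrt (fine (coord n w))).

Let scale_ge0 n w : 0 <= scale n w. Proof. exact: sqrtr_ge0. Qed.

Let scale4 n w : scale n w ^+ 4 = fine (coord n w).
Proof.
rewrite /scale -[4%N]/(2 * 2)%N exprM sqr_sqrtr ?sqrtr_ge0// sqr_sqrtr//.
exact: fine_ge0.
Qed.

Let scale2_le n w : scale n w ^+ 2 <= 1 + fine (coord n w).
Proof.
rewrite -scale4; have := sqr_ge0 (scale n w ^+ 2 - 1).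
have := sqr_ge0 (scale n w).
have -> : scale n w ^+ 4 = (scale n w ^+ 2) ^+ 2 by rewrite -exprM.
by move: (scale n w ^+ 2) => a; nra.
Qed.

Let scale_sum w : good w -> (\sum_(n <oo) (mu n * scale n w ^+ 2)%:E < +oo)%E.
Proof.
move=> gw; apply: (@le_lt_trans _ _
   (\sum_(n <oo) ((mu n)%:E + (mu n)%:E * coord n w))%E).
  apply: lee_nneseries => n; first by rewrite lee_fin mulr_ge0 ?sqr_ge0.
  move=> _; apply: (@le_trans _ _ ((mu n)%:E + (mu n)%:E * (fine (coord n w))%:E)%E).
    rewrite -EFinM -EFinD lee_fin -[X in X + _]mulr1 -mulrDr.
    by rewrite ler_wpM2l.
  rewrite leeD2l// lee_wpmul2l ?lee_fin//.
  by case: (coord n w) (coord_ge0 n w) => [r _|_|//] /=; rewrite ?lexx ?leey.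
rewrite nneseriesD; last 2 first.
- by move=> n _ _; rewrite lee_fin.
- by move=> n _ _; rewrite mule_ge0// lee_fin.
by rewrite lte_add_pinfty.
Qed.

(** Finiteness of [total] says nothing about a coordinate of weight 0, whose [scale] may be the junk
    value [fine +oo = 0]; [X_mu0] makes such a coordinate vanish, so the bounds below hold for it
    too. *)
Let coord_fin w n : good w -> mu n != 0 -> (coord n w < +oo)%E.
Proof.
move=> gw mun; rewrite ltey; apply/negP => /eqP cy.
move: gw; rewrite /good/= ltey => /negP; apply.
apply/eqP; apply: (@nneseries_pinfty _ _ xpredT n) => //.
  by move=> k _; rewrite mule_ge0// lee_fin.
by rewrite cy gt0_muley// lte_fin lt0r mun/=.
Qed.

Let path0 w n : good w -> `|X n 0 w| <= scale n w.
Proof.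
move=> gw; have [mu0|mu0] := eqVneq (mu n) 0; first by rewrite X_mu0// normr0.
rewrite -(@ler_pXn2r _ 4)// ?nnegrE//.
rewrite scale4 -normrX ger0_norm ?exprn_even_ge0// -lee_fin fineK.
  by rewrite leeDl// nneseries_ge0.
by rewrite fin_num_abs gee0_abs ?coord_fin.
Qed.

Let path_incr w n m (k : int) : good w -> `|k%:~R : R| <= 3 ^+ m ->
  `|X n ((k + 1)%:~R / 2 ^+ m) w - X n (k%:~R / 2 ^+ m) w|
    <= scale n w * (19 / 20) ^+ m.
Proof.
move=> gw k3; have r0 : (0 : R) <= 19 / 20 by rewrite divr_ge0.
have [mu0|mu0] := eqVneq (mu n) 0.
  by rewrite !X_mu0// subrr normr0 mulr_ge0// exprn_ge0.
rewrite -(@ler_pXn2r _ 4)// ?nnegrE//; last by rewrite mulr_ge0// exprn_ge0.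
rewrite exprMn scale4 -normrX ger0_norm ?exprn_even_ge0// -/(incr n m k w).
apply: (@le_trans _ _ (fine (coord n w) * (4 / 5) ^+ m)); last first.
  rewrite ler_wpM2l ?fine_ge0// exprAC lerXn2r// ?nnegrE ?divr_ge0// ?exprn_ge0//.
  (* Squaring twice: (19/20)^2 >= 9/10 and (9/10)^2 >= 4/5. *)
  rewrite (exprM _ 2 2); apply: (@le_trans _ _ ((9 / 10) ^+ 2)); first lra.
  by rewrite lerXn2r// ?nnegrE ?divr_ge0//; lra.
have -> : (4 / 5 : R) ^+ m = ((5 / 4) ^+ m)^-1.
  by rewrite -exprVn; congr (_ ^+ _); field.
rewrite ler_pdivlMr ?exprn_gt0// mulrC -lee_fin fineK; last first.
  by rewrite fin_num_abs gee0_abs ?coord_fin.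
apply: (@le_trans _ _ (level n m w)); last first.
  apply: (@le_trans _ _ (\sum_(m <oo) level n m w)%E).
    apply: le_trans (nneseries_lim_ge m.+1 _) => //.
    by rewrite big_nat_recr//= leeDr// sume_ge0.
  by rewrite leeDr// lee_fin exprn_even_ge0.
rewrite EFinM lee_wpmul2l ?lee_fin//.
(* The increment at k is one member of the pair of index |k| in [level]; all other terms are
   nonnegative. *)
have ki : (`|k|%N < (3 ^ m).+1)%N.
  rewrite ltnS -(ler_nat R) natrX; apply: le_trans k3.
  by rewrite -intr_norm -abszE lexx.
rewrite (bigD1 (Ordinal ki))//=.
apply: (@le_trans _ _ ((incr n m (Posz `|k|) w)%:E + (incr n m (- Posz `|k|) w)%:E))%E.
  rewrite -EFinD lee_fin; case: (intP k) => [|j|j].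
  - by rewrite lerDl.
  - by rewrite absz_nat lerDl.
  - by rewrite abszN absz_nat lerDr.
by rewrite leeDl// sume_ge0// => i _; rewrite -EFinD lee_fin addr_ge0.
Qed.

(** The value 0 off [good] makes the next lemmas true for every w and not only almost surely. *)
Definition path_limit (t : R) (w : T) (n : nat) : R :=
  if w \in good then dyadic_limit (fun t => X n t w) t else 0.

Let rho_gt0 : (0 : R) < 19 / 20. Proof. by rewrite divr_gt0. Qed.
Let rho_lt1 : (19 / 20 : R) < 1. Proof. lra. Qed.

Lemma measurable_path_limit n t : measurable_fun setT (fun w => path_limit t w n).
Proof.
apply: (@measurable_fun_cvg _ _ _ _ (fun m w => \1_good w * X n (dyadic_floor m t) w)).
  by move=> m; apply: measurable_funM => //; exact: measurable_indic.
move=> w _; rewrite /path_limit indicE; case: ifPn => [|] /=; last first.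
  by move=> _; under eq_fun do rewrite mul0r; exact: cvg_cst.
rewrite inE => gw; under eq_fun do rewrite mul1r.
apply: (dyadic_limit_cvg rho_gt0 rho_lt1 (h := scale n w)) => [|m k].
  exact: path0.
exact: path_incr.
Qed.

Lemma path_limit_sum t w : (\sum_(n <oo) (mu n * path_limit t w n ^+ 2)%:E < +oo)%E.
Proof.
have [gw|gw] := boolP (w \in good); last first.
  rewrite eseries0// => n _ _.
  by rewrite /path_limit (negbTE gw) expr0n/= mulr0.
have [m tm] := in_range_exists t.
set K := 1 + 3 ^+ m + (1 - (19 / 20))^-1 : R.
apply: (@le_lt_trans _ _ ((K ^+ 2)%:E * \sum_(n <oo) (mu n * scale n w ^+ 2)%:E))%E.
  rewrite -nneseriesZl; last by move=> n _; rewrite lee_fin mulr_ge0 ?sqr_ge0.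
  apply: lee_nneseries => n; first by rewrite lee_fin mulr_ge0 ?sqr_ge0.
  move=> _; rewrite -EFinM lee_fin [leRHS]mulrCA ler_wpM2l// -exprMn.
  rewrite -[leLHS]real_normK ?num_real// lerXn2r// ?nnegrE//.
    by rewrite mulr_ge0// /K !addr_ge0// ?exprn_ge0// invr_ge0; lra.
  rewrite /path_limit gw; move: gw; rewrite inE => gw.
  apply: (dyadic_limit_le rho_gt0 rho_lt1) tm => [|m' k]; first exact: path0.
  exact: path_incr.
rewrite lte_mul_pinfty// ?lee_fin ?sqr_ge0//.
by apply: scale_sum; move: gw; rewrite inE.
Qed.

(** The modulus of continuity is [scale n w] times a factor free of n. That factor leaves the
    weighted sum, and one level m serves all coordinates. *)
Lemma path_limit_continuous t w (e : R) : 0 < e -> \forall s \near t,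
  (\sum_(n <oo) (mu n * (path_limit s w n - path_limit t w n) ^+ 2)%:E <= e%:E)%E.
Proof.
move=> e0; have [gw|gw] := boolP (w \in good); last first.
  apply: filterE => s; rewrite eseries0 ?lee_fin ?ltW// => n _ _.
  by rewrite /path_limit (negbTE gw) subrr expr0n/= mulr0.
have gw' : good w by move: gw; rewrite inE.
pose M := fine (\sum_(n <oo) (mu n * scale n w ^+ 2)%:E)%E.
have sM : (\sum_(n <oo) (mu n * scale n w ^+ 2)%:E = M%:E)%E.
  rewrite /M fineK// fin_num_abs gee0_abs ?scale_sum//.
  by apply: nneseries_ge0 => n _ _; rewrite lee_fin mulr_ge0 ?sqr_ge0.
set K := 2 / (1 - (19 / 20)) + 1 : R.
(* The extra 1 keeps every s within distance 1 of t in the range of level m. *)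
have [m0 tm0] := in_range_exists (`|t| + 1).
have : (K ^+ 2 * M) * ((19 / 20) ^+ 2) ^+ m @[m --> \oo] --> (0 : R).
  rewrite -[X in _ --> X](mulr0 (K ^+ 2 * M)); apply: cvgMr; apply: cvg_expr.
  by rewrite ger0_norm ?exprn_ge0// expr2; lra.
move=> /cvgr0Pnorm_lt/(_ _ e0)[m1 _ m1P].
pose m := maxn m0 m1.
have tm : `|t| + 1 + 1 <= (3 / 2) ^+ m.
  rewrite -{1}[`|t| + 1]ger0_norm ?addr_ge0//.
  by apply: le_trans tm0 _; rewrite ler_eXn2l// ?leq_maxl; lra.
have d0 : (0 : R) < (2 ^+ m)^-1 by rewrite invr_gt0 exprn_gt0.
have d1 : (2 ^+ m)^-1 <= 1 :> R by rewrite invf_le1 ?exprn_gt0// exprn_ege1// ler1n.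
near=> s.
have st : `|s - t| < (2 ^+ m)^-1.
  near: s; exists (2 ^+ m)^-1 => //= s; by rewrite distrC.
apply: (@le_trans _ _ (((K * (19 / 20) ^+ m) ^+ 2)%:E *
   \sum_(n <oo) (mu n * scale n w ^+ 2)%:E)%E).
  rewrite -nneseriesZl; last by move=> n _; rewrite lee_fin mulr_ge0 ?sqr_ge0.
  apply: lee_nneseries => n; first by rewrite lee_fin mulr_ge0 ?sqr_ge0.
  move=> _; rewrite -EFinM lee_fin [leRHS]mulrCA ler_wpM2l// -exprMn.
  rewrite -[leLHS]real_normK ?num_real// lerXn2r// ?nnegrE//.
    rewrite mulr_ge0// mulr_ge0 ?exprn_ge0// addr_ge0// mulr_ge0// invr_ge0; lra.
  rewrite /path_limit gw mulrAC.
  apply: (dyadic_limit_modulus rho_gt0 rho_lt1) => [|m' k|||].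
  - exact: path0.
  - exact: path_incr.
  - apply: le_trans tm; rewrite lerD2r.
    by have := lerB_dist s t; lra.
  - by apply: le_trans tm; lra.
  - exact: ltW.
rewrite sM -EFinM lee_fin exprMn mulrAC -exprM mulnC exprM.
by apply: le_trans (ler_norm _) (ltW (m1P _ _)); rewrite /= leq_maxr.
Unshelve. all: by end_near. Qed.

(** The values at the grid points below t converge to [path_limit] by chaining, and to X n t in L^4
    because those points are within 2^-m of t. *)
Lemma path_limit_ae n t : {ae P, forall w, X n t w = path_limit t w n}.
Proof.
apply: (@ae_eq_of_cvg _ _ _ _ _ _ (fun m => X n (dyadic_floor m t))) => //.
  apply: filterS good_ae => w gw; rewrite /path_limit mem_set//.
  apply: (dyadic_limit_cvg rho_gt0 rho_lt1 (h := scale n w)) => [|m k].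
    exact: path0.
  exact: path_incr.
have : (C * (4^-1) ^+ m)%:E @[m --> \oo] --> 0%E.
  apply: cvg_EFin; first exact: nearW.
  rewrite -[X in _ --> X](mulr0 C); apply: cvgMr; apply: cvg_expr.
  by rewrite ger0_norm; lra.
apply: (squeeze_cvge _ (cvg_cst 0%E)); apply: nearW => m.
apply/andP; split.
  by apply: integral_ge0 => w _; rewrite lee_fin exprn_even_ge0.
apply: le_trans (XB_le _ _ _) _; rewrite lee_fin ler_wpM2l//.
have p2 : (0 : R) < 2 ^+ m by rewrite exprn_gt0.
rewrite pow4V.
have h0 : 0 <= t - dyadic_floor m t.
  by rewrite subr_ge0 ler_pdivrMr// mulrC floor_le_tmp.
rewrite lerXn2r ?nnegrE ?invr_ge0 ?(ltW p2)//.
rewrite lerBlDr -(ler_pM2l p2) mulrDr divff ?gt_eqF// /dyadic_floor.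
rewrite [X in 1 + X]mulrC divfK ?gt_eqF// addrC ltW//.
by have := floorD1_gt (2 ^+ m * t); rewrite intrD.
Qed.

End weighted_paths.

(** * Functionals given by square summable coordinates *)

Local Notation wsum l z := (\sum_(n <oo) (l n ^+ 2 * z n ^+ 2)%:E)%E.

Section inner_product_theory.
Context (R : realType) (V : lmodType R) (q : V -> V -> R).
Hypothesis ipq : inner_product q.

Lemma ip_sym f g : q f g = q g f. Proof. by have [+ _ _] := ipq. Qed.

Lemma ip_linl (a : R) f g k : q (a *: f + g) k = a * q f k + q g k.
Proof. by have [_ + _] := ipq. Qed.

Lemma ip0l g : q 0 g = 0.
Proof. by have := ip_linl (-1) 0 0 g; rewrite scaler0 addr0 mulN1r addNr. Qed.

Lemma ip_Zl a f g : q (a *: f) g = a * q f g.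
Proof. by rewrite -[a *: f]addr0 ip_linl ip0l addr0. Qed.

Lemma ip_Dl f g k : q (f + g) k = q f k + q g k.
Proof. by rewrite -[f]scale1r ip_linl mul1r scale1r. Qed.

Lemma ip_Bl f g k : q (f - g) k = q f k - q g k.
Proof. by rewrite ip_Dl -scaleN1r ip_Zl mulN1r. Qed.

Lemma ip_Zr a f g : q f (a *: g) = a * q f g.
Proof. by rewrite ip_sym ip_Zl ip_sym. Qed.

Lemma ip_Dr f g k : q f (g + k) = q f g + q f k.
Proof. by rewrite ip_sym ip_Dl !(ip_sym f). Qed.

Lemma ip_Br f g k : q f (g - k) = q f g - q f k.
Proof. by rewrite ip_sym ip_Bl !(ip_sym f). Qed.

Lemma ip_subZ_sqr a f g :
  q (f - a *: g) (f - a *: g) = q f f - 2 * a * q g f + a ^+ 2 * q g g.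
Proof. by rewrite ip_Bl !ip_Br !ip_Zl !ip_Zr (ip_sym f g); ring. Qed.

Lemma ip_ge0 f : 0 <= q f f.
Proof.
have [->|f0] := eqVneq f 0; first by rewrite ip0l.
by have [_ _ /(_ f f0)/ltW] := ipq.
Qed.

Lemma form_norm_sqr f : form_norm q f ^+ 2 = q f f.
Proof. by rewrite /form_norm sqr_sqrtr// ip_ge0. Qed.

Variables (e : nat -> V) (supp : nat -> bool).
(** An orthonormal family padded with zero vectors: by definiteness e i = 0 whenever [supp i]
    fails. *)
Hypothesis e_ortho : forall i j, q (e i) (e j) = ((i == j) && supp i)%:R.

Definition fourier_sum f n : V := \sum_(0 <= k < n) q (e k) f *: e k.

Lemma fourier_null n f : ~~ supp n -> q (e n) f = 0.
Proof.
move=> sn; have [->|en] := eqVneq (e n) 0; first exact: ip0l.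
by have [_ _ /(_ _ en)] := ipq; rewrite e_ortho (negbTE sn) andbF ltxx.
Qed.

Lemma ip_sum (a : nat -> R) n j : (n <= j)%N ->
  q (e j) (\sum_(0 <= k < n) a k *: e k) = 0.
Proof.
elim: n => [|n IH] nj; first by rewrite big_nil ip_sym ip0l.
rewrite big_nat_recr//= ip_Dr IH ?(ltnW nj)// add0r ip_Zr e_ortho.
by rewrite gtn_eqF//= mulr0.
Qed.

Lemma ip_sumE (a : nat -> R) n j : (j < n)%N ->
  q (e j) (\sum_(0 <= k < n) a k *: e k) = (supp j)%:R * a j.
Proof.
elim: n => [//|n IH]; rewrite ltnS leq_eqVlt => /predU1P[->|jn].
  by rewrite big_nat_recr//= ip_Dr ip_sum// add0r ip_Zr e_ortho eqxx mulrC.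
by rewrite big_nat_recr//= ip_Dr IH// ip_Zr e_ortho (ltn_eqF jn)/= mulr0 addr0.
Qed.

Lemma bessel_eq f n :
  q (f - fourier_sum f n) (f - fourier_sum f n) =
  q f f - \sum_(0 <= k < n) q (e k) f ^+ 2.
Proof.
elim: n => [|n IH]; first by rewrite /fourier_sum !big_nil !subr0.
rewrite /fourier_sum !big_nat_recr//= -/(fourier_sum f n).
rewrite !opprD !addrA -IH; set g := f - fourier_sum f n.
have egn : q (e n) g = q (e n) f by rewrite /g ip_Br ip_sum// subr0.
rewrite ip_subZ_sqr egn e_ortho eqxx/=.
case: (boolP (supp n)) => [_|/fourier_null ->]; rewrite ?mulr0n ?mulr1n; ring.
Qed.

Lemma bessel f n : \sum_(0 <= k < n) q (e k) f ^+ 2 <= q f f.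
Proof. by rewrite -subr_ge0 -bessel_eq ip_ge0. Qed.

Lemma fourier_coef_sqr_le f k : q (e k) f ^+ 2 <= q f f.
Proof.
apply: le_trans (bessel f k.+1).
by rewrite big_nat_recr//= lerDr sumr_ge0// => i _; rewrite sqr_ge0.
Qed.

Lemma fourier_coef_cvg (u : nat -> V) f k :
  form_norm q (u n - f) @[n --> \oo] --> (0 : R) ->
  q (e k) (u n) @[n --> \oo] --> q (e k) f.
Proof.
move=> uf; apply/subr_cvg0; apply/norm_cvg0P.
apply: (@squeeze_cvgr _ _ _ _ (fun=> 0) (fun n => form_norm q (u n - f)));
  [|exact: cvg_cst|exact: uf].
apply: nearW => n; rewrite normr_ge0/= -ip_Br.
rewrite -sqrtr_sqr /form_norm; apply: ler_wsqrtr; exact: fourier_coef_sqr_le.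
Qed.

(** A Fourier coefficient is continuous for the norm, and along the partial sums of K f the k-th one
    is constant from k+1 on. *)
Lemma diagonal_coef (l : nat -> R) (K : V -> V) f k :
  (forall g, form_norm q
     (\sum_(0 <= k < n) (l k * q (e k) g) *: e k - K g) @[n --> \oo] --> (0 : R)) ->
  q (e k) (K f) = l k * q (e k) f.
Proof.
move=> KE; have := @fourier_coef_cvg _ (K f) k (KE f).
have : q (e k) (\sum_(0 <= i < n) (l i * q (e i) f) *: e i) @[n --> \oo]
    --> l k * q (e k) f.
  apply: cvg_near_cst; exists k.+1 => // n /= kn; rewrite ip_sumE//.
  by case: (boolP (supp k)) => [_|/fourier_null ->]; rewrite ?mul1r ?mulr0.
by move=> h1 h2; exact: (cvg_unique _ h2 h1).
Qed.

End inner_product_theory.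

Lemma norm_mul_le (R : realFieldType) (x a b : R) : 0 < x ->
  `|a * b| <= x / 2 * a ^+ 2 + b ^+ 2 / (2 * x).
Proof.
move=> x0; rewrite -subr_ge0.
have -> : x / 2 * a ^+ 2 + b ^+ 2 / (2 * x) - `|a * b| =
    (x * `|a| - `|b|) ^+ 2 / (2 * x).
  rewrite normrM -[a ^+ 2]real_normK ?num_real// -[b ^+ 2]real_normK ?num_real//.
  by field; rewrite gt_eqF.
by rewrite divr_ge0 ?sqr_ge0// mulr_ge0// ltW.
Qed.

(** Turns the scaled Young inequality of [norm_mul_le] into Cauchy-Schwarz. The choice x = A / G
    already gives A^2 <= M G; if G = 0 < A, then x = (M + 1) / A gives a contradiction. *)
Lemma le_sqrt_of_scaled_bound (R : rcfType) (A G M : R) :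
  0 <= A -> 0 <= G -> 0 <= M ->
  (forall x, 0 < x -> A <= x / 2 * G + M / (2 * x)) ->
  A <= Num.sqrt M * Num.sqrt G.
Proof.
move=> A0 G0 M0 H; rewrite -sqrtrM// -[leLHS]ger0_norm// -sqrtr_sqr.
apply: ler_wsqrtr; move: A0; rewrite le_eqVlt => /predU1P[<-|A0].
  by rewrite expr0n/= mulr_ge0.
move: G0; rewrite le_eqVlt => /predU1P[G0|G0].
  have x0 : 0 < (M + 1) / A by rewrite divr_gt0// ltr_wpDl.
  have := H _ x0; rewrite -G0 mulr0 add0r.
  have -> : M / (2 * ((M + 1) / A)) = A * (M / (2 * (M + 1))).
    by field; rewrite !gt_eqF ?ltr_wpDl.
  rewrite mulr0 -[leLHS]mulr1 ler_pM2l// ler_pdivlMr ?mulr_gt0 ?ltr_wpDl//; lra.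
have := H _ (divr_gt0 A0 G0).
have -> : A / G / 2 * G + M / (2 * (A / G)) = A / 2 + M * G / (2 * A).
  by field; rewrite !gt_eqF.
move=> h; have : A / 2 <= M * G / (2 * A) by lra.
rewrite ler_pdivlMr ?mulr_gt0//.
have -> : A / 2 * (2 * A) = A ^+ 2 by field.
by [].
Qed.

Section series_dual.
Context (R : realType) (V : lmodType R) (q : V -> V -> R).
Hypothesis ipq : inner_product q.
Variables (e : nat -> V) (supp : nat -> bool).
Hypothesis e_ortho : forall i j, q (e i) (e j) = ((i == j) && supp i)%:R.
Variables (l : nat -> R) (K : V -> V).
Hypothesis KE : forall g, form_norm q
  (\sum_(0 <= k < n) (l k * q (e k) g) *: e k - K g) @[n --> \oo] --> (0 : R).

Local Notation W := (range K).
Local Notation qK := (range_form q K).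

Definition pairing (z : nat -> R) (f : V) : R :=
  limn (series (fun k => q (e k) f * z k)).

Let inv (f : V) : V := 'pinv_(fun=> 0) setT K f.

Let KinvK f : W f -> K (inv f) = f.
Proof. by move=> Wf; apply: pinvK; rewrite inE. Qed.

Let coef f k : W f -> q (e k) f = l k * q (e k) (inv f).
Proof. by move=> Wf; rewrite -{1}(KinvK Wf); exact: (diagonal_coef ipq e_ortho). Qed.

(** The weight passes from f to z: the term is the coefficient of the preimage of f under K times l
    k * z k. Bessel's inequality bounds the first factors by r_K, the hypothesis bounds the
    second. *)
Let sum_abs_le z f (M x : R) n : W f -> 0 < x -> (wsum l z <= M%:E)%E ->
  \sum_(0 <= k < n) `|q (e k) f * z k| <= x / 2 * qK f f + M / (2 * x).
Proof.
move=> Wf x0 zM.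
have zMn : \sum_(0 <= k < n) l k ^+ 2 * z k ^+ 2 <= M.
  rewrite -lee_fin -sumEFin; apply: le_trans zM.
  by apply: nneseries_lim_ge => k _ _; rewrite lee_fin mulr_ge0 ?sqr_ge0.
apply: (@le_trans _ _ (\sum_(0 <= k < n)
  (x / 2 * q (e k) (inv f) ^+ 2 + (l k ^+ 2 * z k ^+ 2) / (2 * x)))).
  apply: ler_sum => k _; rewrite coef//.
  set a := q _ _; set b := l k * z k.
  have -> : l k * a * z k = a * b by rewrite /b; ring.
  have -> : l k ^+ 2 * z k ^+ 2 = b ^+ 2 by rewrite /b exprMn.
  exact: norm_mul_le.
rewrite big_split/= -mulr_sumr -mulr_suml; apply: lerD.
  by rewrite ler_wpM2l ?divr_ge0 ?(ltW x0)//; exact: (bessel ipq e_ortho).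
by rewrite ler_wpM2r// invr_ge0 mulr_ge0// ltW.
Qed.

Let wsum_fin z : (wsum l z < +oo)%E -> exists2 M : R, 0 <= M & (wsum l z <= M%:E)%E.
Proof.
have w0 : (0 <= wsum l z)%E.
  by apply: nneseries_ge0 => k _ _; rewrite lee_fin mulr_ge0 ?sqr_ge0.
move=> zy; exists (fine (wsum l z)); first exact: fine_ge0.
by rewrite fineK// fin_num_abs gee0_abs.
Qed.

Lemma pairing_cvg z f : (wsum l z < +oo)%E -> W f ->
  series (fun k => q (e k) f * z k) @ \oo --> pairing z f.
Proof.
move=> /wsum_fin[M M0 zM] Wf; apply: normed_cvg.
have -> : [normed series (fun k => q (e k) f * z k)] =
    series (fun k => `|q (e k) f * z k|) by [].
apply: nondecreasing_is_cvgn.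
  by apply/nondecreasing_seqP => n; rewrite /series/= big_nat_recr//= lerDl.
exists (1 / 2 * qK f f + M / (2 * 1)) => _ [n _ <-].
exact: sum_abs_le.
Qed.

Lemma pairing_le z f (M : R) : 0 <= M -> (wsum l z <= M%:E)%E -> W f ->
  `|pairing z f| <= Num.sqrt M * form_norm qK f.
Proof.
move=> M0 zM Wf; apply: le_sqrt_of_scaled_bound => //.
  exact: (ip_ge0 ipq).
move=> x x0.
have cv : `|series (fun k => q (e k) f * z k) n| @[n --> \oo] --> `|pairing z f|.
  by apply: cvg_norm; apply: pairing_cvg => //; apply: le_lt_trans zM (ltry _).
rewrite -(cvg_lim _ cv)//; apply: limr_le.
  by apply/cvg_ex; eexists; exact: cv.
apply: nearW => n; apply: le_trans (ler_norm_sum _ _ _) _.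
exact: sum_abs_le.
Qed.

Let dual_lin z (hz : (wsum l z < +oo)%E) (a : R) (f g h : W) :
  val h = a *: val f + val g ->
  pairing z (val h) = a * pairing z (val f) + pairing z (val g).
Proof.
have Wv (k : W) : W (val k) by have := valP k; rewrite inE.
move=> hE; apply/cvg_lim => //.
have -> : series (fun k => q (e k) (val h) * z k) =
    (fun n => a * series (fun k => q (e k) (val f) * z k) n +
              series (fun k => q (e k) (val g) * z k) n).
  apply/funext => n; rewrite /series/= mulr_sumr -big_split/=.
  by apply: eq_bigr => k _; rewrite hE ip_Dr// ip_Zr//; ring.
by apply: cvgD; [apply: cvgMr|]; exact: pairing_cvg.
Qed.

Let dual_bnd z (hz : (wsum l z < +oo)%E) : exists C : R, forall f : W,
  `|pairing z (val f)| <= C * form_norm qK (val f).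
Proof.
have [M M0 zM] := wsum_fin hz; exists (Num.sqrt M) => f; apply: pairing_le => //.
by have := valP f; rewrite inE.
Qed.

Definition series_dual z (hz : (wsum l z < +oo)%E) : dual qK W :=
  @Dual R V qK W (fun f => pairing z (val f)) (dual_lin hz) (dual_bnd hz).

Lemma series_dual_dist z y (hz : (wsum l z < +oo)%E) (hy : (wsum l y < +oo)%E) (M : R) :
  0 <= M -> (\sum_(n <oo) (l n ^+ 2 * (z n - y n) ^+ 2)%:E <= M%:E)%E ->
  0 <= dual_dist (series_dual hz) (series_dual hy) <= Num.sqrt M.
Proof.
move=> M0 zyM.
have pB f : W f -> pairing z f - pairing y f = pairing (fun n => z n - y n) f.
  move=> Wf; apply/esym/cvg_lim => //.
  have -> : series (fun k => q (e k) f * (z k - y k)) =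
      (fun n => series (fun k => q (e k) f * z k) n -
                series (fun k => q (e k) f * y k) n).
    apply/funext => n; rewrite /series/= -sumrB.
    by apply: eq_bigr => k _; rewrite mulrBr.
  by apply: cvgB; exact: pairing_cvg.
rewrite /dual_dist /dual_norm; set S := [set _ | _ in _].
have Sle : ubound S (Num.sqrt M).
  move=> _ [f f1 <-] /=; have Wf : W (val f) by have := valP f; rewrite inE.
  rewrite pB//; apply: le_trans (pairing_le M0 zyM Wf) _.
  by rewrite -[leRHS]mulr1 ler_wpM2l ?sqrtr_ge0.
(* [sup] is 0 by convention on the empty set; otherwise any element of S, being an absolute value,
   shows that it is nonnegative. *)
have [->|/set0P[s Ss]] := eqVneq S set0; first by rewrite sup0 lexx sqrtr_ge0.
apply/andP; split; last by apply: ge_sup => //; exists s.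
apply: (@le_trans _ _ s); first by case: Ss => f _ <-.
by apply: ub_le_sup => //; exists (Num.sqrt M).
Qed.

End series_dual.

Section weighted_sums.
Context (R : realType) (l : nat -> R).
Implicit Types x y z : nat -> R.

Lemma wsum_ge0 z : (0 <= wsum l z)%E.
Proof. by apply: nneseries_ge0 => n _ _; rewrite lee_fin mulr_ge0 ?sqr_ge0. Qed.

Lemma wsumZ (a : R) z :
  (\sum_(n <oo) (l n ^+ 2 * (a * z n) ^+ 2)%:E = (a ^+ 2)%:E * wsum l z)%E.
Proof.
rewrite -nneseriesZl; last by move=> n _; rewrite lee_fin mulr_ge0 ?sqr_ge0.
by apply: eq_eseriesr => n _; rewrite -EFinM; congr EFin; ring.
Qed.

Lemma wsumD_le x y :
  (\sum_(n <oo) (l n ^+ 2 * (x n + y n) ^+ 2)%:E <=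
   2%:E * wsum l x + 2%:E * wsum l y)%E.
Proof.
rewrite -!nneseriesZl; try by move=> n _; rewrite lee_fin mulr_ge0 ?sqr_ge0.
rewrite -nneseriesD; try by move=> n _ _; rewrite mule_ge0// lee_fin mulr_ge0 ?sqr_ge0.
apply: lee_nneseries => n; first by rewrite lee_fin mulr_ge0 ?sqr_ge0.
move=> _; rewrite -!EFinM -EFinD lee_fin.
have := mulr_ge0 (sqr_ge0 (l n)) (sqr_ge0 (x n - y n)).
by move: (l n ^+ 2) (x n) (y n) => a b c; nra.
Qed.

Hypothesis l_sum : (\sum_(n <oo) (l n ^+ 2)%:E < +oo)%E.

(** Separability of the weighted l^2 space. Beyond the list [nth] returns 0, so the tail of z costs
    at most eps/2; on the head one precision fits all terms since the weights sum to L, and L + 1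
    avoids a division by 0. *)
Lemma wsum_rat_approx z (eps : R) : (wsum l z < +oo)%E -> 0 < eps ->
  exists s : seq rat,
    (\sum_(n <oo) (l n ^+ 2 * (z n - ratr (nth 0 s n)) ^+ 2)%:E <= eps%:E)%E.
Proof.
move=> zfin e0.
have e20 : 0 < eps / 2 by rewrite divr_gt0.
have z0 k : (0 <= (l k ^+ 2 * z k ^+ 2)%:E)%E by rewrite lee_fin mulr_ge0 ?sqr_ge0.
have /fine_cvgP[[N1 _ finN1] /cvgr0Pnorm_lt/(_ _ e20)[N2 _ N2P]] :=
  nneseries_tail_cvg zfin (fun k _ => z0 k).
pose N := maxn N1 N2.
have tailN : (\sum_(N <= k <oo) (l k ^+ 2 * z k ^+ 2)%:E <= (eps / 2)%:E)%E.
  rewrite -[leLHS]fineK; last by apply: finN1; rewrite /= leq_maxl.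
  rewrite lee_fin; apply: le_trans (ler_norm _) (ltW _).
  by apply: N2P; rewrite /= leq_maxr.
pose L := fine (\sum_(n <oo) (l n ^+ 2)%:E)%E.
have L0 : 0 <= L by apply: fine_ge0; apply: nneseries_ge0 => n _ _; rewrite lee_fin sqr_ge0.
have LE : (\sum_(n <oo) (l n ^+ 2)%:E)%E = L%:E.
  rewrite /L fineK// fin_num_abs gee0_abs//.
  by apply: nneseries_ge0 => n _ _; rewrite lee_fin sqr_ge0.
have d0 : 0 < eps / (2 * (L + 1)) by rewrite divr_gt0// mulr_gt0// ltr_wpDl.
set delta := Num.sqrt (eps / (2 * (L + 1))).
have delta0 : 0 < delta by rewrite sqrtr_gt0.
have ratz k : exists r : rat, (z k - ratr r) ^+ 2 <= eps / (2 * (L + 1)).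
  have [|r] := @rat_in_itvoo R (z k - delta) (z k); first by rewrite ltrBlDr ltrDl.
  rewrite in_itv/= => /andP[r1 r2]; exists r.
  rewrite -[leRHS]sqr_sqrtr ?(ltW d0)// -/delta lerXn2r// ?nnegrE ?(ltW delta0)//; lra.
pose s := mkseq (fun k => sval (cid (ratz k))) N.
exists s; rewrite (@nneseries_split _ _ 0%N N) ?add0n; last first.
  by move=> k _; rewrite lee_fin mulr_ge0 ?sqr_ge0.
have -> : eps = eps / 2 + eps / 2 by field.
rewrite EFinD; apply: leeD.
  apply: (@le_trans _ _ (\sum_(0 <= k < N) ((eps / (2 * (L + 1)))%:E * (l k ^+ 2)%:E))%E).
    rewrite big_nat [leRHS]big_nat; apply: lee_sum => k /= kN.
    rewrite nth_mkseq// -EFinM lee_fin mulrC ler_wpM2r ?sqr_ge0//.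
    by case: cid.
  under eq_bigr do rewrite -EFinM.
  rewrite sumEFin lee_fin -mulr_sumr.
  have lL : \sum_(0 <= k < N) l k ^+ 2 <= L.
    rewrite -lee_fin -LE -sumEFin; apply: nneseries_lim_ge => k _ _.
    by rewrite lee_fin sqr_ge0.
  apply: (@le_trans _ _ (eps / (2 * (L + 1)) * L)); first by rewrite ler_wpM2l// ltW.
  have -> : eps / (2 * (L + 1)) * L = eps / 2 * (L / (L + 1)).
    by field; rewrite gt_eqF// ltr_wpDl.
  by rewrite ler_piMr ?(ltW e20)// ler_pdivrMr ?ltr_wpDl//; lra.
apply: le_trans tailN; rewrite le_eqVlt; apply/orP; left; apply/eqP.
apply/congr_lim/funext => n; apply: eq_big_nat => k /andP[Nk _].
rewrite nth_default ?size_mkseq//.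
by rewrite rmorph0 subr0.
Qed.

End weighted_sums.

Section series_dual_process.
Context (R : realType) (V : lmodType R) (q : V -> V -> R).
Hypothesis ipq : inner_product q.
Variables (e : nat -> V) (supp : nat -> bool).
Hypothesis e_ortho : forall i j, q (e i) (e j) = ((i == j) && supp i)%:R.
Variables (l : nat -> R) (K : V -> V).
Hypothesis KE : forall g, form_norm q
  (\sum_(0 <= k < n) (l k * q (e k) g) *: e k - K g) @[n --> \oo] --> (0 : R).
Hypothesis l_sum : (\sum_(n <oo) (l n ^+ 2)%:E < +oo)%E.
Context d (Omega : measurableType d) (P : probability Omega R).

Local Notation W := (range K).
Local Notation qK := (range_form q K).
Local Notation D := (series_dual ipq e_ortho KE).

(* An open set of the dual pulls back to a countable union of weighted l^2
   balls centered at finite rational sequences, the distance of the dual being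
   at most the l^2 one. *)
Lemma series_dual_random_variable (z : Omega -> nat -> R)
    (hz : forall w, (wsum l (z w) < +oo)%E) :
  (forall n, measurable_fun setT (fun w => z w n)) ->
  dual_random_variable (fun w => D (hz w)).
Proof.
move=> mz; set Y := fun w => D (hz w).
suff openY U : dual_open U -> measurable (Y @^-1` U).
  move=> C /(_ [set C | measurable (Y @^-1` C)]); apply; split=> //; split.
  - by rewrite /= preimage_set0.
  - by move=> A mA /=; rewrite setTD preimage_setC; exact: measurableC.
  - by move=> A mA /=; rewrite preimage_bigcup; exact: bigcupT_measurable.
move=> oU.
pose ball (i : seq rat * nat) : set Omega := [set w |
  (\sum_(n <oo) (l n ^+ 2 * (z w n - ratr (nth 0%R i.1 n)) ^+ 2)%:E < (i.2.+1%:R^-1)%:E)%E].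
pose inU (i : seq rat * nat) := forall y (hy : (wsum l y < +oo)%E),
  (\sum_(n <oo) (l n ^+ 2 * (y n - ratr (nth 0%R i.1 n)) ^+ 2)%:E < (i.2.+1%:R^-1)%:E)%E ->
  U (D hy).
have mball i : measurable (ball i).
  rewrite -[ball i]setTI; apply: emeasurable_fun_infty_o => //.
  apply: (ge0_emeasurable_sum (P := xpredT)) => k.
    by move=> w _ _; rewrite lee_fin mulr_ge0 ?sqr_ge0.
  move=> _; apply/measurable_EFinP; apply: measurable_funM => //.
  by apply: measurable_funX; exact: measurable_funB.
have -> : Y @^-1` U = \bigcup_i (if `[< inU i >] then ball i else set0).
  apply/seteqP; split => [w /= Uw|w [i _]]; last first.
    by case: asboolP => // iU wi; exact: iU.
  have [e0 e0_gt0 near_w] := oU _ Uw.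
  (* Radii are squared distances: two points of a ball of radius 1 / (k + 1) are within 4 / (k + 1)
     of each other, by (a + b)^2 <= 2 a^2 + 2 b^2, and this must stay below e0^2. *)
  have [k _ /(_ k (leqnn k)) kP] : \forall k \near \oo, (k.+1%:R^-1 : R) < e0 ^+ 2 / 4.
    apply: (@cvgr_lt _ _ _ _ _ _ (@cvg_harmonic R)).
    by rewrite divr_gt0 ?exprn_gt0.
  have k0 : (0 : R) < k.+1%:R^-1 by rewrite invr_gt0.
  have [s sP] := wsum_rat_approx l_sum (hz w) (divr_gt0 k0 (ltr0n R 2)).
  have wball : ball (s, k) w.
    rewrite /ball/=; apply: le_lt_trans sP _.
    by rewrite lte_fin ltr_pdivrMr// ltr_pMr// ltr1n.
  exists (s, k) => //; case: asboolP => // -[] y hy ys; apply: near_w.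
  have yz : (\sum_(n <oo) (l n ^+ 2 * (y n - z w n) ^+ 2)%:E <=
      (4 * k.+1%:R^-1)%:E)%E.
    apply: (@le_trans _ _ (2%:E * (k.+1%:R^-1)%:E + 2%:E * (k.+1%:R^-1)%:E))%E; last first.
      by rewrite -!EFinM -EFinD lee_fin -mulrDl -natrD.
    have := wsumD_le l (fun n => y n - ratr (nth 0 s n)) (fun n => ratr (nth 0 s n) - z w n).
    under eq_eseriesr do rewrite addrA subrK.
    move=> /le_trans; apply; apply: leeD; rewrite lee_wpmul2l//; first exact: ltW.
    under eq_eseriesr do rewrite -[(_ - _) ^+ 2]sqrrN opprB.
    exact: ltW wball.
  have /andP[_] := series_dual_dist ipq e_ortho KE hy (hz w) (mulr_ge0 (ler0n R 4) (ltW k0)) yz.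
  move=> /le_lt_trans; apply.
  rewrite -[ltRHS]ger0_norm ?(ltW e0_gt0)// -sqrtr_sqr ltr_sqrt ?exprn_gt0//.
  by rewrite mulrC -ltr_pdivlMr.
apply: countable_bigcupT_measurable => // i.
by case: asboolP => // _; exact: measurable0.
Qed.

End series_dual_process.

(** * Regular versions from coordinates *)

Section coordinates.
Context (R : realType) (V : lmodType R) (q : V -> V -> R).
Hypothesis ipq : inner_product q.
Variables (e : nat -> V) (supp : nat -> bool).
Hypothesis e_ortho : forall i j, q (e i) (e j) = ((i == j) && supp i)%:R.
Hypothesis e_total : forall f,
  form_norm q (fourier_sum q e f n - f) @[n --> \oo] --> (0 : R).
Variables (l : nat -> R) (K : V -> V).
Hypothesis KE : forall g, form_norm q
  (\sum_(0 <= k < n) (l k * q (e k) g) *: e k - K g) @[n --> \oo] --> (0 : R).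
Hypothesis l_sum : (\sum_(n <oo) (l n ^+ 2)%:E < +oo)%E.
Context d (Omega : measurableType d) (P : probability Omega R).
Variables (Y : R -> Omega -> {linear V -> R^o}) (z : R -> Omega -> nat -> R).
Hypothesis mY : linear_process Y.
Hypothesis Y4 : forall t, exists2 C : R, 0 <= C & forall f,
  (\int[P]_w ((Y t w f : R) ^+ 4)%:E <= (C * q f f ^+ 2)%:E)%E.
Hypothesis mz : forall t n, measurable_fun setT (fun w => z t w n).
Hypothesis z_sum : forall t w, (wsum l (z t w) < +oo)%E.
Hypothesis z_continuous : forall t w (eps : R), 0 < eps -> \forall s \near t,
  (\sum_(n <oo) (l n ^+ 2 * (z s w n - z t w n) ^+ 2)%:E <= eps%:E)%E.
Hypothesis z_ae : forall n t, {ae P, forall w, (Y t w (e n) : R) = z t w n}.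

Let Y' t w := series_dual ipq e_ortho KE (z_sum t w).

Let Y'_process : dual_process Y'.
Proof. by move=> t; exact: series_dual_random_variable. Qed.

Let Y'_continuous : sample_continuous Y'.
Proof.
move=> w t; apply/cvgr0Pnorm_le => eps e0.
apply: filterS (z_continuous t w (exprn_gt0 2 e0)) => s st.
have /andP[d0 dle] := series_dual_dist ipq e_ortho KE (z_sum s w) (z_sum t w)
  (sqr_ge0 eps) st.
by rewrite ger0_norm//; apply: le_trans dle _; rewrite sqrtr_sqr gtr0_norm.
Qed.

(** By linearity in f, the field at a Fourier partial sum of f is almost surely a partial sum of the
    pairing; [Y4] turns convergence of the Fourier sums in norm into convergence in L^4. *)
Let Y'_regular t : regular_version P (Y t) (Y' t).
Proof.
split; first exact: Y'_process.
move=> f; have Wf : range K (val f) by have := valP f; rewrite inE.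
suff : {ae P, forall w, (Y t w (val f) : R) = pairing q e (z t w) (val f)}.
  by apply: filterS => w ->.
apply: (@ae_eq_of_cvg _ _ _ _ _ _ (fun n w => Y t w (fourier_sum q e (val f) n))).
- exact: mY.
- by move=> n; exact: mY.
- apply: filterS (ae_foralln (fun n => z_ae n t)) => w Yz.
  have -> : (fun n => Y t w (fourier_sum q e (val f) n) : R) =
      series (fun k => q (e k) (val f) * z t w k).
    apply/funext => n; rewrite /fourier_sum linear_sum/=.
    by apply: eq_bigr => k _; rewrite linearZ/= Yz.
  exact: (pairing_cvg ipq e_ortho KE).
have [C C0 CP] := Y4 t.
have : (C * (form_norm q (fourier_sum q e (val f) n - val f)) ^+ 4)%:E
    @[n --> \oo] --> 0%E.
  apply: cvg_EFin; first exact: nearW.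
  rewrite -[X in _ --> X](mulr0 C); apply: cvgMr.
  rewrite -[X in _ --> X](expr0n _ 4)/=.
  by apply: (cvg_comp _ (fun y : R => y ^+ 4)) (e_total _) _; exact: exprn_continuous.
apply: (squeeze_cvge _ (cvg_cst 0%E)); apply: nearW => n.
apply/andP; split.
  by apply: integral_ge0 => w _; rewrite lee_fin exprn_even_ge0.
rewrite (exprM _ 2 2) form_norm_sqr//; apply: le_trans (CP _).
rewrite le_eqVlt; apply/orP; left; apply/eqP; apply: eq_integral => w _.
have subC4 (a b : R) : (a - b) ^+ 4 = (b - a) ^+ 4 by ring.
by rewrite linearB/= [in RHS]subC4.
Qed.

Lemma has_continuous_regular_version_of_coordinates :
  has_continuous_regular_version (range_form q K) (range K) P Y.
Proof.
exists Y', Y' => //; split => // t.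
by apply: nearW.
Qed.

End coordinates.

(** * Moments of the increments of a two-sided Brownian field *)

(** This makes the increments stationary in time: the two halves of the line are uncorrelated, so
    across 0 the variances |s| and |t| add up to |s - t|. *)
Lemma norm_add_sub_min (R : realDomainType) (s t : R) :
  `|s| + `|t| - 2 * (if 0 < s * t then Num.min `|s| `|t| else 0) = `|s - t|.
Proof.
wlog st : s t / s <= t => [H|].
  have [|/ltW] := leP s t; first exact: H.
  by move=> /H h; rewrite [RHS]distrC -h [t * s]mulrC minC [`|t| + _]addrC.
rewrite [RHS]distrC [RHS]ger0_norm ?subr_ge0//.
have [s0|s0] := leP 0 s.
  have t0 := le_trans s0 st; rewrite !ger0_norm// min_l//.
  case: ltP => [_|]; first by lra.
  by move=> st0; nra.
have [t0|t0] := leP 0 t.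
  by rewrite ltNge nmulr_rle0// t0/= (ger0_norm t0) (ltr0_norm s0); lra.
rewrite nmulr_rgt0// t0 !ltr0_norm// min_r ?lerN2//; lra.
Qed.

Section second_moments.
Context (R : realType) d (T : measurableType d) (P : probability T R).

Lemma Lfun2_of_integral_sqr (X : T -> R) (v : R) : measurable_fun setT X ->
  (\int[P]_w (X w ^+ 2)%:E = v%:E)%E -> X \in Lfun P 2%:E.
Proof.
move=> mX Xv; rewrite inE/=; apply/andP; split; rewrite inE//=.
rewrite /finite_norm unlock poweR_lty//.
under eq_integral => w _ do
  rewrite poweR_EFin powR_mulrn// real_normK ?num_real//.
by rewrite Xv ltry.
Qed.

Lemma covariance_centered (X Y : T -> R) : ('E_P[X] = 0)%E -> ('E_P[Y] = 0)%E ->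
  covariance P X Y = (\int[P]_w (X w * Y w)%:E)%E.
Proof.
move=> X0 Y0; rewrite unlock X0 Y0 unlock; apply: eq_integral => w _.
by rewrite !fctE /= !subr0.
Qed.

Lemma integral_sqrB (X Y : T -> R) (a b c : R) :
  measurable_fun setT X -> measurable_fun setT Y ->
  ('E_P[X] = 0)%E -> ('E_P[Y] = 0)%E ->
  covariance P X X = a%:E -> covariance P Y Y = b%:E ->
  covariance P X Y = c%:E ->
  (\int[P]_w ((X w - Y w) ^+ 2)%:E = (a + b - 2 * c)%:E)%E.
Proof.
move=> mX mY X0 Y0 XX YY XY.
have X2 : X \in Lfun P 2%:E.
  by apply: (@Lfun2_of_integral_sqr _ a) => //; rewrite -XX covariance_centered.
have Y2 : Y \in Lfun P 2%:E.
  by apply: (@Lfun2_of_integral_sqr _ b) => //; rewrite -YY covariance_centered.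
have Pfin : P setT \is a fin_num := fin_num_measure P _ measurableT.
have B0 : ('E_P[X \- Y] = 0)%E.
  by rewrite expectationB ?(Lfun_subset12 Pfin)// X0 Y0 sube0.
transitivity (variance P (X \- Y)).
  by rewrite /variance covariance_centered.
by rewrite varianceB// /variance XX YY XY.
Qed.

End second_moments.

Section brownian_moments.
Context (R : realType) d (T : measurableType d) (P : probability T R).
Context (V : lmodType R) (q : V -> V -> R) (c : R).
Variable B : R -> T -> {linear V -> R^o}.
Hypothesis hB : brownian_field P (fun f g => c * q f g) B.

Let mB t f : measurable_fun setT (fun w => B t w f : R).
Proof. by have [+ _ _] := hB; exact. Qed.

Let EB t f : ('E_P[fun w => B t w f : R] = 0)%E.
Proof. by have [_ [_ +] _] := hB => /(_ (f, t)). Qed.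

Let covB t f : covariance P (fun w => B t w f : R) (fun w => B t w f : R) =
  (`|t| * (c * q f f))%:E.
Proof.
have [_ _ ->] := hB; congr EFin; rewrite -expr2 exprn_even_gt0//= minxx.
by have [->|//] := eqVneq t 0; rewrite normr0 mul0r.
Qed.

Lemma brownian_fourth_moment : exists2 C : R, 0 <= C &
  (forall t f, (\int[P]_w ((B t w f : R) ^+ 4)%:E <=
     (C * (`|t| * q f f) ^+ 2)%:E)%E) /\
  (forall s t f, (\int[P]_w (((B s w f : R) - B t w f) ^+ 4)%:E <=
     (C * (`|s - t| * q f f) ^+ 2)%:E)%E).
Proof.
have [C C1 CP] := gaussian_fourth_moment P.
have [_ [gB _] covst] := hB.
exists (C * c ^+ 2); first by rewrite mulr_ge0 ?sqr_ge0// (le_trans _ C1).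
split=> [t f|s t f].
  have -> : C * c ^+ 2 * (`|t| * q f f) ^+ 2 = C * (`|t| * (c * q f f)) ^+ 2 by ring.
  apply: CP.
    have := gB 1%N (fun=> 1) (fun=> (f, t)).
    by under eq_fun do rewrite big_ord1 mul1r.
  by rewrite -covB covariance_centered.
have -> : C * c ^+ 2 * (`|s - t| * q f f) ^+ 2 = C * (`|s - t| * (c * q f f)) ^+ 2 by ring.
apply: CP.
  have := gB 2%N (fun k => (-1) ^+ k) (fun k => (f, if k == ord0 then s else t)).
  by under eq_fun do rewrite !big_ord_recl big_ord0/= expr0 expr1 mul1r mulN1r addr0.
rewrite (integral_sqrB _ _ _ _ (covB s f) (covB t f) (covst f f s t))//.
congr EFin; rewrite -mulrDl.
have -> : (if 0 < s * t then Num.min `|s| `|t| * (c * q f f) else 0) =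
  (if 0 < s * t then Num.min `|s| `|t| else 0) * (c * q f f).
  by case: ifP => // _; rewrite mul0r.
by move: (c * q f f) => u; rewrite [2 * _]mulrA -mulrBl norm_add_sub_min.
Qed.

End brownian_moments.

(** * The Brownian and the stationary field *)

Section brownian_regular_version.
Context (R : realType) dO (T : measurableType dO) (P : probability T R).
Context (V : lmodType R) (q : V -> V -> R) (c : R).
Hypothesis ipq : inner_product q.
Variable B : R -> T -> {linear V -> R^o}.
Hypothesis hB : brownian_field P (fun f g => c * q f g) B.
Variables (J : set nat) (d : nat -> V) (lambda : nat -> R) (K : V -> V).
Hypothesis hd : orthonormal_basis q J d.
Hypothesis lambda_gt0 : forall n, J n -> 0 < lambda n.
Hypothesis lambda_sum : (\sum_(0 <= n <oo | n \in J) (lambda n ^+ 2)%:E < +oo)%E.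
Hypothesis hK : diagonal_operator q J d lambda K.

(** Outside J vector and weight become 0, so that all sums run over all of nat, whether J is finite
    or not. *)
Let e n : V := if n \in J then d n else 0.
Let l n : R := if n \in J then lambda n else 0.
Let supp n : bool := n \in J.

Let e_ortho i j : q (e i) (e j) = ((i == j) && supp i)%:R.
Proof.
have q0l := ip0l ipq; have q0r f : q f 0 = 0 by rewrite ip_sym.
rewrite /e /supp; have [iJ|iJ] := boolP (i \in J); last by rewrite q0l andbF.
rewrite andbT; have [jJ|jJ] := boolP (j \in J).
  by have [-> ] := hd => //; rewrite -inE.
by rewrite q0r; case: eqVneq => // ij; rewrite -ij iJ in jJ.
Qed.

Let e_total f : form_norm q (fourier_sum q e f n - f) @[n --> \oo] --> (0 : R).
Proof.
have [_ /(_ f)] := hd; apply: cvg_trans; apply: near_eq_cvg; apply: nearW => n.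
congr (form_norm q (_ - f)); rewrite big_mkcond/=; apply: eq_bigr => k _.
by rewrite /e; case: ifP => _; rewrite ?scaler0.
Qed.

Let KE g : form_norm q
  (\sum_(0 <= k < n) (l k * q (e k) g) *: e k - K g) @[n --> \oo] --> (0 : R).
Proof.
apply: cvg_trans (hK g); apply: near_eq_cvg; apply: nearW => n.
congr (form_norm q (_ - _)); rewrite big_mkcond/=; apply: eq_bigr => k _.
by rewrite /e /l; case: ifP => _; rewrite ?scaler0.
Qed.

Let l_sum : (\sum_(n <oo) (l n ^+ 2)%:E < +oo)%E.
Proof.
apply: le_lt_trans lambda_sum; rewrite [leRHS]eseries_mkcond le_eqVlt.
apply/orP; left; apply/eqP; apply: eq_eseriesr => n _.
by rewrite /l; case: ifP => // _; rewrite expr0n.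
Qed.

Let X n t (w : T) : R := B t w (e n).

Let mX n t : measurable_fun setT (X n t).
Proof. by have [+ _ _] := hB; exact. Qed.

(** The weights are positive on J, so a zero weight means a padded index, where e n = 0 and
    linearity of B t w applies at every w. *)
Let X_l0 n t w : l n ^+ 2 = 0 -> X n t w = 0.
Proof.
rewrite /X /e /l; case: ifP => [/set_mem nJ|_ _]; last by rewrite linear0.
by move=> /eqP; rewrite sqrf_eq0 gt_eqF// lambda_gt0.
Qed.

Let qe_le n : q (e n) (e n) <= 1.
Proof. by rewrite e_ortho eqxx; case: (supp n). Qed.

Lemma brownian_linear_process : linear_process B. Proof. by have [] := hB. Qed.

Let coordinates_exist : exists z : R -> T -> nat -> R,
  [/\ forall t n, measurable_fun setT (fun w => z t w n),
      forall t w, (\sum_(n <oo) (l n ^+ 2 * z t w n ^+ 2)%:E < +oo)%E,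
      forall t w (eps : R), 0 < eps -> \forall s \near t,
       (\sum_(n <oo) (l n ^+ 2 * (z s w n - z t w n) ^+ 2)%:E <= eps%:E)%E &
      forall n t, {ae P, forall w, (B t w (e n) : R) = z t w n}].
Proof.
have [C C0 [C1 C2]] := brownian_fourth_moment hB.
pose mu n := l n ^+ 2.
have X0_le n : (\int[P]_w (X n 0 w ^+ 4)%:E <= C%:E)%E.
  apply: le_trans (C1 _ _) _; rewrite normr0 mul0r expr0n/= mulr0 lee_fin//.
have XB_le n s t :
    (\int[P]_w ((X n s w - X n t w) ^+ 4)%:E <= (C * (s - t) ^+ 2)%:E)%E.
  apply: le_trans (C2 _ _ _) _; rewrite lee_fin ler_wpM2l// exprMn.
  rewrite real_normK ?num_real// ler_piMr ?sqr_ge0// exprn_ile1//.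
  exact: ip_ge0.
have mu_ge0 n : 0 <= mu n by exact: sqr_ge0.
exists (path_limit X mu); split.
- by move=> t n; exact: measurable_path_limit.
- by move=> t w; exact: path_limit_sum.
- by move=> t w; exact: path_limit_continuous.
- by move=> n t; exact: (path_limit_ae mX mu_ge0 l_sum X0_le XB_le).
Qed.

Lemma brownian_has_continuous_regular_version :
  has_continuous_regular_version (range_form q K) (range K) P B.
Proof.
have [z [mz z_sum z_cont z_ae]] := coordinates_exist.
have [C C0 [C1 C2]] := brownian_fourth_moment hB.
apply: (has_continuous_regular_version_of_coordinates ipq e_ortho e_total KE l_sum
  brownian_linear_process _ mz z_sum z_cont z_ae) => t.
exists (C * `|t| ^+ 2); first by rewrite mulr_ge0 ?sqr_ge0.
by move=> f; rewrite -mulrA -exprMn; exact: C1.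
Qed.

Variable gamma : R.

Lemma stationary_linear_process : linear_process (stationary_field gamma B).
Proof.
move=> t f; rewrite /stationary_field/=.
apply: (@measurable_funM _ _ _ _ (cst _)) => //; exact: brownian_linear_process.
Qed.

Lemma stationary_has_continuous_regular_version :
  has_continuous_regular_version (range_form q K) (range K) P
    (stationary_field gamma B).
Proof.
have [z [mz z_sum z_cont z_ae]] := coordinates_exist.
have [C C0 [C1 C2]] := brownian_fourth_moment hB.
pose a t := expR (- `|gamma| * t) * (Num.sqrt (2 * `|gamma|))^-1.
pose b t := expR (2 * `|gamma| * t).
have a_cont : continuous a.
  move=> t; apply: cvgMl; apply: continuous_comp; last exact: continuous_expR.
  by apply: cvgMr; exact: cvg_id.
have b_cont : continuous b.
  move=> t; apply: continuous_comp; last exact: continuous_expR.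
  by apply: cvgMr; exact: cvg_id.
apply: (has_continuous_regular_version_of_coordinates ipq e_ortho e_total KE l_sum
  stationary_linear_process (z := fun t w n => a t * z (b t) w n)).
- move=> t; exists (C * (a t ^+ 2 * `|b t|) ^+ 2).
    by rewrite mulr_ge0 ?sqr_ge0.
  move=> f; rewrite /stationary_field/=.
  under eq_integral => w _ do rewrite -/(a t) -/(b t) exprMn EFinM.
  rewrite ge0_integralZl ?lee_fin ?exprn_even_ge0//; first last.
  + by move=> w _; rewrite lee_fin exprn_even_ge0.
  + by apply/measurable_EFinP; apply: measurable_funX; exact: brownian_linear_process.
  apply: (@le_trans _ _ ((a t ^+ 4)%:E * (C * (`|b t| * q f f) ^+ 2)%:E)%E).
    by rewrite lee_wpmul2l ?lee_fin ?exprn_even_ge0.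
  by rewrite -EFinM lee_fin le_eqVlt; apply/orP; left; apply/eqP; ring.
- by move=> t n; apply: measurable_funM.
- move=> t w; rewrite wsumZ lte_mul_pinfty ?lee_fin ?sqr_ge0//.
- move=> t w eps eps0.
  have fin := z_sum (b t) w.
  pose M := fine (\sum_(n <oo) (l n ^+ 2 * z (b t) w n ^+ 2)%:E)%E.
  have w0 := wsum_ge0 l (z (b t) w).
  have M0 : 0 <= M by exact: fine_ge0.
  have ME : (\sum_(n <oo) (l n ^+ 2 * z (b t) w n ^+ 2)%:E = M%:E)%E.
    by rewrite /M fineK// fin_num_abs gee0_abs.
  (* A bounds a(s)^2 as soon as |a(s) - a(t)| < 1. *)
  pose A := (`|a t| + 1) ^+ 2.
  have A0 : 0 < A by rewrite exprn_gt0// ltr_wpDl.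
  have d1 : 0 < eps / (4 * A) by rewrite divr_gt0// mulr_gt0.
  have d2 : 0 < eps / (4 * (M + 1)) by rewrite divr_gt0// mulr_gt0// ltr_wpDl.
  have n1 : \forall s \near t, (\sum_(n <oo)
      (l n ^+ 2 * (z (b s) w n - z (b t) w n) ^+ 2)%:E <= (eps / (4 * A))%:E)%E.
    exact: (b_cont t _ (z_cont (b t) w _ d1)).
  have d2r : 0 < Num.sqrt (eps / (4 * (M + 1))) by rewrite sqrtr_gt0.
  have /cvgr_dist_lt aP : a s @[s --> t] --> a t := a_cont t.
  have n2 := aP _ ltr01; have n3 := aP _ d2r.
  apply: filterS3 n1 n2 n3 => s zs as1 as2.
  have := wsumD_le l (fun n => a s * (z (b s) w n - z (b t) w n))
     (fun n => (a s - a t) * z (b t) w n).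
  rewrite !wsumZ ME.
  (* The product rule separates the change of time from the rescaling. Each part gets eps/4, since
     [wsumD_le] doubles both. *)
  have split n : a s * (z (b s) w n - z (b t) w n) + (a s - a t) * z (b t) w n =
      a s * z (b s) w n - a t * z (b t) w n by ring.
  under eq_eseriesr do rewrite split.
  move=> /le_trans; apply.
  have -> : eps%:E = (2%:E * (eps / 4)%:E + 2%:E * (eps / 4)%:E)%E.
    by rewrite -!EFinM -EFinD; congr EFin; field.
  apply: leeD; rewrite lee_wpmul2l//.
    apply: (@le_trans _ _ (A%:E * (eps / (4 * A))%:E)%E).
      apply: lee_pmul => //; first by rewrite lee_fin sqr_ge0.
      - exact: wsum_ge0.
      - rewrite lee_fin -[leLHS]real_normK ?num_real// lerXn2r ?nnegrE ?addr_ge0//.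
        by have := lerB_dist (a s) (a t); rewrite distrC; lra.
    by rewrite -EFinM lee_fin le_eqVlt; apply/orP; left; apply/eqP; field; rewrite gt_eqF.
  rewrite -EFinM lee_fin.
  apply: (@le_trans _ _ (eps / (4 * (M + 1)) * M)).
    rewrite ler_wpM2r// -[leRHS]sqr_sqrtr ?(ltW d2)// -[leLHS]real_normK ?num_real//.
    by rewrite lerXn2r ?nnegrE ?sqrtr_ge0// distrC ltW.
  have -> : eps / (4 * (M + 1)) * M = eps / 4 * (M / (M + 1)).
    by field; rewrite gt_eqF// ltr_wpDl.
  by rewrite ler_piMr ?divr_ge0 ?(ltW eps0)// ler_pdivrMr ?ltr_wpDl//; lra.
- move=> n t; apply: filterS (z_ae n (b t)) => w <-.
  by rewrite /stationary_field/=.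
Qed.

End brownian_regular_version.

(** * The covariance form as a multiple of r *)

Section brownian_form_theory.
Context d (S : measurableType d) (R : realType) (pi : probability S R).

Lemma L2dotNr (f g : L2 pi) : L2dot f (- g) = - L2dot f g.
Proof.
have dotC (u v : L2 pi) : L2dot u v = L2dot v u.
  by rewrite /L2dot; apply: eq_Rintegral => x _; rewrite mulrC.
have dot0 : L2dot 0 f = 0.
  by have := L2dotP (-1) 0 0 f; rewrite scaler0 addr0 mulN1r addNr.
by rewrite dotC -[- g]addr0 -scaleN1r L2dotP dot0 addr0 mulN1r dotC.
Qed.

(* The factors 1 - gamma that r puts in front of f and g are taken out by the
   bilinearity of r itself, rather than by the linearity of A^-1. *)
Lemma brownian_form_r_form (Ainv : L2 pi -> L2 pi) (gamma : R) : gamma < 0 ->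
  inner_product (r_form Ainv gamma) ->
  brownian_form Ainv =
  (fun f g => 2 * `|gamma| / (1 - gamma) ^+ 2 * r_form Ainv gamma f g).
Proof.
move=> g0 ipr; apply/funext => f; apply/funext => g.
have a0 : 1 - gamma != 0 by rewrite gt_eqF//; lra.
have shift h : (1 - gamma)^-1 *: h - Gamma gamma ((1 - gamma)^-1 *: h) = h.
  by rewrite /Gamma -[X in X - _]scale1r -scalerBl scalerA divff// scale1r.
have : r_form Ainv gamma ((1 - gamma)^-1 *: f) ((1 - gamma)^-1 *: g) =
    (1 - gamma)^-1 * ((1 - gamma)^-1 * r_form Ainv gamma f g).
  by rewrite (ip_Zr ipr) (ip_Zl ipr).
rewrite {1}/r_form !shift /p_form L2dotNr => rE.
have gn0 : `|gamma| != 0 by rewrite normr_eq0 lt_eqF.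
transitivity (2 * `|gamma| * (`|gamma|^-1 * - L2dot (val f) (Ainv (val g)))).
  by rewrite /brownian_form; field.
by rewrite rE; field; rewrite a0.
Qed.

End brownian_form_theory.
Theorem corollary3p2 (R : realType)
  (dS : measure_display) (S : measurableType dS) (pi : probability S R)
  (dO : measure_display) (Omega : measurableType dO) (P : probability Omega R)
  (p : R -> R.-pker S ~> S) (F : R -> set (set Omega)) (X : R -> Omega -> S)
  (hX : ergodic_markov_process P pi p F X)
  (T : R -> L2 pi -> L2 pi)
  (hT : transition_semigroup p T) (hTc : strongly_continuous T)
  (A : L2 pi -> L2 pi) (hAT : A = generator T)
  (hA : generator_assumption (generator_dom T) A)
  (Ainv : L2 pi -> L2 pi) (hAinv : Ainv = reduced_inverse (generator_dom T) A)
  (dB : measure_display) (OmegaB : measurableType dB)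
  (PB : probability OmegaB R)
  (B : R -> OmegaB -> {linear perp1_space pi -> R^o})
  (hB : brownian_field PB (brownian_form Ainv) B)
  (gamma : R) (hgamma : gamma < 0)
  (r : perp1_space pi -> perp1_space pi -> R) (hr : r = r_form Ainv gamma)
  (hrH : separable_hilbert r)
  (J : set nat) (d : nat -> perp1_space pi) (hd : orthonormal_basis r J d)
  (lambda : nat -> R) (hlambda : forall n, J n -> 0 < lambda n)
  (hsum : (\sum_(0 <= n <oo | n \in J) (lambda n ^+ 2)%:E < +oo)%E)
  (K : perp1_space pi -> perp1_space pi)
  (hK : diagonal_operator r J d lambda K) :
  (linear_process B /\
   has_continuous_regular_version (range_form r K) (range K) PB B) /\
  (linear_process (stationary_field gamma B) /\
   has_continuous_regular_version (range_form r K) (range K) PB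
     (stationary_field gamma B)).
Proof.
subst r; have [ipr _ _] := hrH.
have bf := brownian_form_r_form hgamma ipr; rewrite bf in hB.
split; split.
- exact: (brownian_linear_process hB).
- exact: (brownian_has_continuous_regular_version ipr hB hd hlambda hsum hK).
- exact: (stationary_linear_process hB).
- exact: (stationary_has_continuous_regular_version ipr hB hd hlambda hsum hK).
Qed.
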